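(* Let $G=(V,E)$ be a Gaussian polytree and let $a,c,b\in V$ with $a\ne c$, $c\neq b$, $a\in an(c)$ and $c\in an(b)$. Let $z\in V\setminus\{a,b,c\}$ be a vertex for which $\rho^2_{ac\mid \{b,z\}}\neq\rho^2_{ac\mid b}$. Then: 1. $\rho^2_{ac\mid\{b,z\}}>\rho^2_{ac\mid b}$ if and only if $a\perp\!\!\!\perp z$ and $c\not\perp\!\!\!\perp z$. 2. $\rho^2_{ac\mid\{b,z\}}<\rho^2_{ac\mid b}$ if and only if either $c\perp\!\!\!\perp z$ or $a\not\perp\!\!\!\perp z$.
   Context: A polytree is a finite directed acyclic graph (DAG) whose skeleton (the undirected graph obtained by replacing directed edges by undirected ones) is a tree, so that two vertices are joined by at most one path (edge directions disregarded). A vertex $y$ is an ancestor of $x$ if $y=x$ or there is a directed path from $y$ to $x$; $an(x)$ is the set of ancestors of $x$ and $an(X)=\bigcup_{x\in X}an(x)$. A non-endpoint vertex $v$ on a path is a collider on it if both path edges at $v$ point into $v$, and a non-collider otherwise. A path between $x$ and $y$ is d-connecting given $Z$ (possibly empty, $x,y\notin Z$) if no non-collider on it is in $Z$ and every collider on it is in $an(Z)$; $x,y$ are d-separated given $Z$ if no path between them is d-connecting given $Z$; disjoint sets $X,Y$ are d-separated given $Z$ if every $x\in X$, $y\in Y$ are. A Gaussian polytree is a polytree with a Gaussian random vector indexed by $V$, distributed as $N(\mu,\Sigma)$ with $\Sigma$ positive definite, such that for disjoint $X,Y,Z$ one has conditional independence of $X$ and $Y$ given $Z$ whenever $X$ and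 $Y$ are d-separated given $Z$. $\perp\!\!\!\perp$ denotes (unconditional) probabilistic independence and $\not\perp\!\!\!\perp$ its negation. For distinct $u,v$ and nonempty $Z\subseteq V\setminus\{u,v\}$ the squared partial correlation is $$\rho^2_{uv\mid Z}=\frac{(\sigma_{uv}-\Sigma_{uZ}\Sigma_{ZZ}^{-1}\Sigma_{Zv})^2}{(\sigma_{uu}-\Sigma_{uZ}\Sigma_{ZZ}^{-1}\Sigma_{Zu})(\sigma_{vv}-\Sigma_{vZ}\Sigma_{ZZ}^{-1}\Sigma_{Zv})},$$ where $\sigma_{uv}$ is the $(u,v)$ entry of $\Sigma$ and $\Sigma_{uZ}$ etc. are submatrices. *)

(* Defs.v *)
From HB Require Import structures.
From mathcomp Require Import all_boot all_order all_algebra.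
From mathcomp Require Import all_classical all_reals all_analysis.

Set Implicit Arguments.
Unset Strict Implicit.
Unset Printing Implicit Defensive.

Import Order.TTheory GRing.Theory Num.Theory.
Import numFieldNormedType.Exports.

Local Open Scope ring_scope.

Section Graph.
Variables (V : finType) (E : rel V).
Implicit Types (u v x y : V) (p : seq V) (A B Z : {set V}).

Definition skeleton : rel V := fun u v => E u v || E v u.

(* A loop or a pair of opposite edges is a directed cycle. *)
Definition is_dag : Prop := forall p, cycle E p -> p = [::].

(* Sequences of length at most 2 are degenerate closed walks, not cycles of a
   simple graph. *)
Definition is_tree (e : rel V) : Prop :=
  (forall u v, connect e u v) /\ (forall p, ucycle e p -> (size p <= 2)%N).

Definition is_polytree : Prop := is_dag /\ is_tree skeleton.

Definition ancestor y x : bool := connect E y x.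

Definition ancestors Z : {set V} := [set y | [exists x in Z, ancestor y x]]%SET.

(* The path is x :: p; the inner vertices are those at positions 1, ...,
   size p - 1, and the default value of nth is never used. *)
Definition d_connecting x p Z : Prop :=
  forall i, (i.+1 < size p)%N ->
    let u := nth x (x :: p) i in
    let v := nth x (x :: p) i.+1 in
    let w := nth x (x :: p) i.+2 in
    if E u v && E w v then v \in ancestors Z else v \notin Z.

Definition d_separated x y Z : Prop :=
  ~ exists p, [/\ path skeleton x p, uniq (x :: p), last x p = y
                & d_connecting x p Z].

Definition d_separated_sets A B Z : Prop :=
  forall x y, x \in A -> y \in B -> d_separated x y Z.

End Graph.

Section Probability.
Local Open Scope classical_set_scope.
Context d (T : measurableType d) (R : realType) (P : probability T R).

Definition independent (X Y : {RV P >-> R}) : Prop :=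
  forall A B : set R, measurable A -> measurable B ->
    P (X @^-1` A `&` Y @^-1` B) = (P (X @^-1` A) * P (Y @^-1` B))%E.

(* g is a version of the conditional probability P(A | G), where G is a
   sub-sigma-algebra. *)
Definition cond_prob_version (G : set (set T)) (A : set T) (g : T -> R)
    : Prop :=
  [/\ forall B : set R, measurable B -> G (g @^-1` B),
      P.-integrable setT (EFin \o g)
    & forall C, G C -> (\int[P]_(x in C) (g x)%:E = P (A `&` C))%E].

(* P(A n B | G) = P(A | G) P(B | G) almost surely, for all A in F1, B in F2;
   versions are unique up to null sets, so it is enough to exhibit one. *)
Definition cond_independent_sigma (F1 F2 G : set (set T)) : Prop :=
  forall A B, F1 A -> F2 B ->
    exists f g : T -> R,
      [/\ cond_prob_version G A f, cond_prob_version G B g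
        & cond_prob_version G (A `&` B) (f \* g)].

Variable V : finType.
Implicit Types (X : V -> {RV P >-> R}) (S : {set V}).

(* The sigma-algebra generated by the X v with v in S; it is trivial when S is
   empty, and conditioning on it is then unconditional. *)
Definition sigma_of X S : set (set T) :=
  <<s [set A | exists v (B : set R),
        [/\ v \in S, measurable B & A = X v @^-1` B] ] >>.

Definition cond_independent X S1 S2 S3 : Prop :=
  cond_independent_sigma (sigma_of X S1) (sigma_of X S2) (sigma_of X S3).

Definition positive_definite (Sigma : V -> V -> R) : Prop :=
  (forall u v, Sigma u v = Sigma v u) /\
  (forall t : V -> R, (exists v, t v != 0) ->
     0 < \sum_u \sum_v t u * Sigma u v * t v).

(* X ~ N(mu, Sigma), for Sigma positive definite: every nontrivial linear
   combination t.X is univariate normal with mean t.mu and variance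
   t^T Sigma t. The second parameter of normal_prob is the standard deviation;
   t = 0 is left out because normal_prob m 0 is not a point mass. *)
Definition gaussian_vector X (mu : V -> R) (Sigma : V -> V -> R) : Prop :=
  forall t : V -> R, (exists v, t v != 0) ->
    forall A : set R, measurable A ->
      P ((fun x => \sum_v t v * X v x) @^-1` A) =
      normal_prob (\sum_v t v * mu v)
        (Num.sqrt (\sum_u \sum_v t u * Sigma u v * t v)) A.

Record gaussian_polytree (E : rel V) X (mu : V -> R) (Sigma : V -> V -> R)
    : Prop := GaussianPolytree {
  gp_polytree : is_polytree E;
  gp_posdef : positive_definite Sigma;
  gp_gaussian : gaussian_vector X mu Sigma;
  gp_markov : forall S1 S2 S3 : {set V},
    [disjoint S1 & S2]%B -> [disjoint S1 & S3]%B -> [disjoint S2 & S3]%B ->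
    d_separated_sets E S1 S2 S3 -> cond_independent X S1 S2 S3
}.

End Probability.

Section PartialCorrelation.
Variables (R : realType) (V : finType) (Sigma : V -> V -> R).
Implicit Types (u v : V) (A B Z : {set V}).

(* The submatrix Sigma_AB, rows and columns in the order of enum A, enum B. *)
Definition cov_block A B : 'M[R]_(#|A|, #|B|) :=
  \matrix_(i, j) Sigma (enum_val i) (enum_val j).

Definition partial_cov u v Z : R :=
  Sigma u v -
  \sum_(i < #|Z|) \sum_(j < #|Z|)
    Sigma u (enum_val i) * invmx (cov_block Z Z) i j * Sigma (enum_val j) v.

Definition sq_partial_corr u v Z : R :=
  partial_cov u v Z ^+ 2 / (partial_cov u u Z * partial_cov v v Z).

End PartialCorrelation.

(* Main.v *)
(* In a polytree let m be the first vertex on the directed path from a through c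
   to b that is met when walking from z. The orientation of the last edge of this
   walk and the position of m relative to a and c decide which of a, b, c, z are
   separated. Separation by a single vertex m gives corr u v = corr u m * corr m v,
   and a collider gives independence. Hence one of three patterns holds: m separates
   a, c and z from one another and c separates z from b; or a is independent of z and
   c separates z from b; or corr a z = corr a c * corr c z. In each of them the
   difference of the two squared partial correlations factors, which shows its sign.

   The Markov property only speaks about sigma-algebras, so correlations must be
   extracted from it. Write L_t for the centred linear form with coefficients t.
   If L_y and L_s are uncorrelated, then L_s + e L_y and L_s - e L_y have the same
   law; integrating a symmetric difference quotient of x^+ and letting e tend to 0
   shows that L_y integrates to 0 over each event determined by L_s. No density,
   characteristic function or joint law is needed. Conversely, if L_y integrates
   to 0 over the half-space L_s > 0, then L_y and L_s are uncorrelated. *)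

Require Import Defs.
From HB Require Import structures.
From mathcomp Require Import all_boot all_order all_algebra.
From mathcomp Require Import finmap zify ring lra.
From mathcomp Require Import all_classical all_reals all_analysis.
From mathcomp Require Import measurable_realfun.

Set Implicit Arguments.
Unset Strict Implicit.
Unset Printing Implicit Defensive.

Import Order.TTheory GRing.Theory Num.Theory.
Import numFieldNormedType.Exports.

Local Open Scope ring_scope.

(** * Separation in polytrees *)

Section Polytree.
Variables (V : finType) (E : rel V).
Hypothesis polytreeE : is_polytree E.
Implicit Types (u v w x y : V) (p q s l r : seq V).

Local Notation sk := (skeleton E).

Lemma skeleton_sym : symmetric sk.
Proof. by move=> u v; rewrite /skeleton orbC. Qed.

Lemma dag_asym u v : E u v -> E v u = false.
Proof.
move=> uv; apply/negP => vu; have [dag _] := polytreeE.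
by have /dag : cycle E [:: u; v] by rewrite /= uv vu.
Qed.

Lemma dag_path_uniq x p : path E x p -> uniq (x :: p).
Proof.
have [dag _] := polytreeE.
elim: p x => // y p IHp x xp; rewrite cons_uniq IHp ?andbT; last first.
  by case/andP: xp.
apply/negP => xin; move: xp; case/splitPr: xin => p1 p2.
rewrite cat_path /= => /andP[p1x /andP[px _]].
by have /dag : cycle E (x :: p1) by rewrite /= rcons_path p1x px.
Qed.

Lemma rev_skeleton_sorted s : sorted sk (rev s) = sorted sk s.
Proof. by rewrite rev_sorted; apply: eq_sorted => u v; exact: skeleton_sym. Qed.

Lemma sorted_skeleton s : sorted E s -> sorted sk s.
Proof. by apply: sub_sorted => u v; rewrite /skeleton => ->. Qed.

(** Cuts a walk at its first meeting with another one, so that the part before the cut avoids that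
    other one. *)
Lemma split_first_mem s q : has (mem q) s ->
  exists s1 m s2, [/\ s = s1 ++ m :: s2, m \in q & ~~ has (mem q) s1].
Proof.
elim: s => //= x s IHs.
case: (boolP (x \in q)) => [xq _|xq /= /IHs [s1 [m [s2 [-> mq s1q]]]]].
  by exists [::], x, s.
by exists (x :: s1), m, s2; split; rewrite //= negb_or xq.
Qed.

(* Two simple paths with distinct first steps close up to a cycle at the first
   vertex of one of them that lies on the other. *)
Lemma simple_path_unique x p q : path sk x p -> uniq (x :: p) ->
  path sk x q -> uniq (x :: q) -> last x p = last x q -> p = q.
Proof.
have [_ [_ nocycle]] := polytreeE.
elim: p q x => [|u p IHp] [|v q] x //.
- by move=> _ _ _ /[1!cons_uniq] /andP[xq _] /= e; move: xq; rewrite e mem_last.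
- by move=> _ /[1!cons_uniq] /andP[xp _] _ _ /= e; move: xp; rewrite -e mem_last.
move=> xp /[1!cons_uniq] /andP[xNp up] xq /[1!cons_uniq] /andP[xNq uq] e.
have [uv|uv] := eqVneq u v.
  subst v; congr cons; apply: (IHp _ u) => //.
  - by case/andP: xp.
  - by case/andP: xq.
exfalso.
have /split_first_mem [p1 [m [p2 [pE mq p1q]]]] : has (mem (v :: q)) (u :: p).
  apply/hasP; exists (last u p); first exact: mem_last.
  by rewrite inE (e : last u p = last v q) mem_last.
have {mq} [q1 [q2 qE]] : exists q1 q2, v :: q = q1 ++ m :: q2.
  by case/path.splitPr: mq => q1 q2; exists q1, q2.
have q1p1 : (0 < size q1 + size p1)%N.
  rewrite lt0n addn_eq0; apply/negP => /andP[/nilP q10 /nilP p10].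
  by move: pE qE; rewrite p10 q10 => -[um _] [vm _]; rewrite um vm eqxx in uv.
rewrite {}pE in xp xNp up; rewrite {}qE in xq xNq uq p1q.
(* Out from [x] to [m] along one path and back along the other. By [q1p1] there is a vertex besides
   [x] and [m], so the size exceeds 2. *)
have /nocycle : ucycle sk (x :: p1 ++ m :: rev q1).
  rewrite /ucycle /= rcons_cat /= cat_path /= cat_uniq /= rev_uniq.
  move: xp xq; rewrite !cat_path /= => /and3P[-> -> _] /and3P[xq1 q1m _] /=.
  apply/andP; split.
    rewrite -rev_cons -[path _ _ _]/(sorted sk (m :: rev (x :: q1))) -rev_rcons.
    by rewrite rev_skeleton_sorted /= rcons_path xq1.
  move: up uq xNp xNq; rewrite !cat_uniq => /and3P[-> + _] /and3P[-> + _] /=.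
  rewrite /= !negb_or => /andP[-> _] /andP[q1Nm _].
  rewrite !mem_cat !inE mem_rev !negb_or => /and3P[-> -> _] /and3P[-> _ _].
  rewrite [m \in rev q1]mem_rev q1Nm /= andbT.
  rewrite has_rev has_sym; apply: contra p1q => /hasP[y yp1 yq1].
  by apply/hasP; exists y => //; rewrite inE mem_cat [y \in q1]yq1.
by rewrite /= size_cat /= size_rev; lia.
Qed.

Definition simple_path s := sorted sk s && uniq s.

Lemma simple_path_rev s : simple_path (rev s) = simple_path s.
Proof. by rewrite /simple_path rev_skeleton_sorted rev_uniq. Qed.

Lemma simple_path_cat s1 s2 :
  simple_path (s1 ++ s2) -> simple_path s1 /\ simple_path s2.
Proof.
rewrite /simple_path cat_uniq => /andP[/cat_sorted2[-> ->] /and3P[-> _ ->]].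
by [].
Qed.

(** Serves to leave the walk from [z] where it hits the directed path and to follow that path
    instead. *)
Lemma simple_path_join s1 m s2 t : simple_path (s1 ++ m :: s2) ->
  simple_path (m :: t) -> ~~ has (mem (m :: t)) s1 ->
  simple_path (s1 ++ m :: t).
Proof.
rewrite /simple_path !sorted_cat_cons !cat_uniq => /andP[/andP[-> _] /andP[-> _]].
by move=> /andP[mt ->] s1t; rewrite -[path _ _ _]/(sorted sk (m :: t)) mt has_sym s1t.
Qed.

(** Simple paths between two given vertices are unique, so one blocked triple excludes every
    d-connecting path. Writing the initial part as [rcons l u] names the predecessor of [v]; the
    start [head u l] is [u] itself when [l] is empty. *)
Lemma d_separated_blocked l u v w r y (Z : {set V}) :
  simple_path (rcons l u ++ [:: v, w & r]) -> y \in w :: r ->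
  (if E u v && E w v then v \notin ancestors E Z else v \in Z) ->
  d_separated E (head u l) y Z.
Proof.
move=> lr; set x := head u l => yr blocked [p [xp up py dcon]].
case/splitPl: yr lr => r1 r2 ry.
rewrite -!cat_cons catA => /simple_path_cat[lr _].
have [p' p'E] : exists p', rcons l u ++ [:: v, w & r1] = x :: p'.
  by rewrite /x; case: (l) => [|k l'] /=; eexists.
move: (lr); rewrite p'E => /andP[xp' up'].
have pp' : p = p'.
  apply: (simple_path_unique xp) => //.
  by rewrite py -[RHS]/(last x (x :: p')) -p'E last_cat.
(* [u] has index [size l] on the path, so the condition at this index concerns the triple [u], [v],
   [w]. *)
have := dcon (size l); rewrite pp' -p'E.
have -> : nth x (rcons l u ++ [:: v, w & r1]) (size l) = u.
  by rewrite nth_cat size_rcons ltnSn nth_rcons ltnn eqxx.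
have -> : nth x (rcons l u ++ [:: v, w & r1]) (size l).+1 = v.
  by rewrite nth_cat size_rcons ltnn subnn.
have -> : nth x (rcons l u ++ [:: v, w & r1]) (size l).+2 = w.
  by rewrite nth_cat size_rcons ltnNge leqnSn /= subSnn.
have -> : ((size l).+1 < size p')%N.
  by rewrite -ltnS -[(size p').+1]/(size (x :: p')) -p'E size_cat size_rcons /=; lia.
by move=> /(_ isT) /=; move: blocked; case: ifP => _ => [/negPf->|->].
Qed.

Lemma d_separated_collider l u v w r y :
  simple_path (rcons l u ++ [:: v, w & r]) -> y \in w :: r ->
  E u v -> E w v -> d_separated E (head u l) y finset.set0.
Proof.
move=> lr yr uv wv; apply: (d_separated_blocked lr yr); rewrite uv wv inE.
by apply/negP => /existsP[x]; rewrite inE.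
Qed.

Lemma d_separated_noncollider l u v w r y :
  simple_path (rcons l u ++ [:: v, w & r]) -> y \in w :: r ->
  E v u || E v w -> d_separated E (head u l) y [set v]%SET.
Proof.
move=> lr yr out; apply: (d_separated_blocked lr yr); rewrite inE eqxx.
by case/orP: out => /dag_asym ->; rewrite ?andbF.
Qed.

(* An endpoint counts as separating: the correlation identity is then trivial. *)
Definition separates m u v := [\/ m = u, m = v | d_separated E u v [set m]%SET].

(** If [s] is empty, [m] is itself the starting point; otherwise a path edge leaves [m], which is
    then a non-collider. *)
Lemma separates_junction s m t y : simple_path (s ++ m :: t) -> y \in t ->
  [|| E m (last m s), nilp s | E m (head m t)] -> separates m (head m s) y.
Proof.
case/lastP: s => [|s u] st; first by constructor 1.
case: t st => // w t st yt; rewrite /nilp size_rcons last_rcons /= => out.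
apply: Or33; have -> : head m (rcons s u) = head u s by case: (s).
exact: (d_separated_noncollider st yt).
Qed.

Lemma d_separated_junction s m t y : simple_path (s ++ m :: t) -> y \in t ->
  s != [::] -> E (last m s) m -> E (head m t) m ->
  d_separated E (head m s) y finset.set0.
Proof.
case/lastP: s => // s u st; case: t st => // w t st yt _; rewrite last_rcons /=.
have -> : head m (rcons s u) = head u s by case: (s).
exact: (d_separated_collider st yt).
Qed.

(** The form with [rev] fits a walk that turns at [m] and runs backwards along [s]. *)
Lemma sorted_edges s m t : sorted E (s ++ m :: t) ->
  (s != [::] -> E (head m (rev s)) m) /\ (t != [::] -> E m (head m t)).
Proof.
rewrite sorted_cat_cons => /andP[]; case/lastP: s => [|s u].
  by split=> //; case: t b => //= w t /andP[].
rewrite rev_rcons /= => sm mt; split; last by case: t mt => //= w t /andP[].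
move=> _; case: (s) sm => [|x s']; rewrite /= ?andbT //.
by rewrite !rcons_path last_rcons => /andP[].
Qed.

(* With m the first vertex of the path from a to b met from z, the cases are: m is
   not a collider and not after c; a collider after a and not after c; a collider
   after c; not a collider and after c. *)
Lemma separation_cases a b c z : ancestor E a c -> ancestor E c b ->
    a != c -> c != b -> z != a -> z != b -> z != c ->
  separates c a b /\
  [\/ separates c z b /\
        exists m, [/\ separates m z a, separates m z c & separates m a c],
      separates c z b /\ d_separated E z a finset.set0,
      d_separated E z a finset.set0 /\ d_separated E z c finset.set0
    | separates c z a /\
        exists m, [/\ separates m z c, separates m z b & separates m b c]].
Proof.
move=> /connectP[p1 ap1 cE] /connectP[p2 cp2 bE] ac cb za zb zc.
case/lastP: p1 ap1 cE => [_ /= ca|A c' ap1]; first by rewrite ca eqxx in ac.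
rewrite last_rcons => cc'; subst c'.
case: p2 cp2 bE => [_ /= bc|n B cp2 bE]; first by rewrite bc eqxx in cb.
have dirP : sorted E ((a :: A) ++ c :: n :: B).
  by rewrite /= -cat_rcons cat_path ap1 last_rcons.
have simpleP : simple_path ((a :: A) ++ c :: n :: B).
  by apply/andP; split; [exact: sorted_skeleton|exact: dag_path_uniq].
have Ecn : E c n by case/andP: cp2.
have bnB : b \in n :: B by rewrite bE /=; exact: mem_last.
split.
  apply: (separates_junction simpleP bnB); by rewrite Ecn !orbT.
(* A simple path from [z] to [a] ends on the directed path from [a] to [b]; [m] is its first vertex
   there and [q1] the part before [m]. *)
have [_ [conn _]] := polytreeE.
have /connectP[q0' zq0' aE'] := conn z a.
case/shortenP: zq0' aE' => q0 zq0 uq0 _ aE {q0'}.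
have /split_first_mem [q1 [m [q2 [zE mP q1P]]]] :
    has (mem ((a :: A) ++ c :: n :: B)) (z :: q0).
  by apply/hasP; exists a; rewrite ?inE ?eqxx // aE; exact: mem_last.
have simpleq : simple_path (q1 ++ m :: q2) by rewrite -zE; apply/andP.
have hz s x : head x (q1 ++ m :: s) = z by case: (q1) zE => [|? ?] [].
have hzm : head m q1 = z by case: (q1) zE => [|? ?] [].
(* Since [q1] avoids the directed path, it extends beyond [m] to a simple path in both
   directions. *)
have junction l r : (a :: A) ++ c :: n :: B = l ++ m :: r ->
    [/\ simple_path (q1 ++ m :: rev l), simple_path (q1 ++ m :: r),
        l != [::] -> E (head m (rev l)) m & r != [::] -> E m (head m r)].
  move=> PE; move: simpleP q1P dirP; rewrite PE has_sym.
  move=> simpleP + /sorted_edges[? ?]; rewrite has_cat negb_or => /andP[q1l q1r].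
  split=> //.
    apply: (simple_path_join simpleq).
      rewrite -rev_rcons simple_path_rev -cats1.
      by move: simpleP; rewrite -cat1s catA => /simple_path_cat[].
    rewrite has_sym /= negb_or has_rev q1l andbT.
    by move: q1r; rewrite /= negb_or => /andP[].
  apply: (simple_path_join simpleq); last by rewrite has_sym.
  by case: (simple_path_cat simpleP).
(* The walk enters [m] by an edge into [m] or by an edge out of [m], or it is trivial because [z] is
   [m]. *)
have cut : (q1 != [::]) && E (last m q1) m || (E m (last m q1) || nilp q1).
  case/lastP: (q1) simpleq => [|s w]; first by rewrite !orbT.
  rewrite last_rcons cat_rcons => /simple_path_cat[_ /andP[/andP[+ _] _]].
  by rewrite -size_eq0 size_rcons /skeleton => /orP[->|->]; rewrite ?orbT.
move: mP; rewrite mem_cat [m \in c :: _]inE => /or3P[mA|/eqP mc|mB].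
- have [l [A2 AE]] : exists l A2, a :: A = l ++ m :: A2.
    by case/path.splitPr: mA => l A2; exists l, A2.
  have := junction l (A2 ++ c :: n :: B); rewrite AE -catA => /(_ erefl).
  case=> [Fl Gr El Er].
  have /Er {}Er : A2 ++ c :: n :: B != [::] by case: (A2).
  have czb : separates c z b.
    rewrite -(hz A2 c); apply: (separates_junction _ bnB).
      by rewrite -catA.
    by rewrite Ecn !orbT.
  have cA2 : c \in A2 ++ c :: n :: B by rewrite mem_cat !inE eqxx orbT.
  (* If [m] is [a], no edge of the directed path enters [m], and the first pattern holds whatever
     the orientation of the last edge of the walk. *)
  have [lnil|lnil] := eqVneq l [::].
    have am : a = m by move: AE; rewrite lnil => -[].
    apply: Or41; split=> //; exists m; split.
    + by apply: Or32.
    + by rewrite -hzm; apply: (separates_junction Gr cA2); rewrite Er !orbT.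
    + by apply: Or31.
  have arl : a \in rev l.
    by rewrite mem_rev; case: (l) lnil AE => //= ? ? _ [-> _]; rewrite inE eqxx.
  have amE : head m l = a by case: (l) lnil AE => //= ? ? _ [].
  (* An edge of the walk into [m] meets the edge of the directed path into [m], so [m] is a collider
     between [z] and [a]. *)
  case/orP: cut => [/andP[q1nil into]|out].
    apply: Or42; split=> //; rewrite -hzm.
    by apply: (d_separated_junction Fl arl) => //; apply: El.
  apply: Or41; split=> //; exists m; split.
  + by rewrite -hzm; apply: (separates_junction Fl arl); rewrite orbA out.
  + by rewrite -hzm; apply: (separates_junction Gr cA2); rewrite orbA out.
  + rewrite -amE; apply: (@separates_junction l m (A2 ++ c :: n :: B)) => //.
      by rewrite -cat_cons catA -AE.
    by rewrite Er !orbT.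
- subst m; have [Fl Gr El Er] := junction (a :: A) (n :: B) erefl.
  have arl : a \in rev (a :: A) by rewrite mem_rev mem_head.
  have czb : separates c z b.
    by rewrite -hzm; apply: (separates_junction Gr bnB); rewrite Ecn !orbT.
  case/orP: cut => [/andP[q1nil into]|out].
    apply: Or42; split=> //; rewrite -hzm.
    by apply: (d_separated_junction Fl arl) => //; apply: El.
  apply: Or41; split=> //; exists c; split.
  + by rewrite -hzm; apply: (separates_junction Fl arl); rewrite orbA out.
  + by apply: Or32.
  + by apply: Or32.
have [B1 [B2 BE]] : exists B1 B2, n :: B = B1 ++ m :: B2.
  by case/path.splitPr: mB => B1 B2; exists B1, B2.
have := junction ((a :: A) ++ c :: B1) B2; rewrite BE -catA => /(_ erefl).
case=> Fl Gr El Er.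
have crl : c \in rev ((a :: A) ++ c :: B1).
  by rewrite mem_rev mem_cat mem_head orbT.
have arl : a \in rev ((a :: A) ++ c :: B1) by rewrite mem_rev mem_head.
(* Now [m] comes after [c], so a collider at [m] blocks the way from [z] to both [c] and [a]. *)
case/orP: cut => [/andP[q1nil into]|out].
  by apply: Or43; split; rewrite -hzm; apply: (d_separated_junction Fl) => //; apply: El.
(* The path from [m] back to [a] reaches [c] from [n], against the edge from [c] to [n]; hence [c]
   is a non-collider on it. *)
have lastB1 : last m (rev B1) = n.
  by case: (B1) BE => [|? ?] [-> _] //; rewrite rev_cons last_rcons.
have bB2 : last m B2 = b.
  by rewrite bE -[RHS]/(last c (n :: B)) BE last_cat.
apply: Or44; split.
  rewrite -(hz (rev B1) c).
  apply: (@separates_junction (q1 ++ m :: rev B1) c (rev (a :: A))).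
  + by move: Fl; rewrite rev_cat rev_cons cat_rcons -catA.
  + by rewrite mem_rev mem_head.
  + by rewrite last_cat /= lastB1 Ecn.
(* If nothing follows [m], then [m] is [b] and the two separations involving [b] hold by the
   endpoint clauses. *)
have [B2nil|B2nil] := eqVneq B2 [::].
  have mb : m = b by rewrite -bB2 B2nil.
  exists m; split; [|exact: Or32|exact: Or31].
  by rewrite -hzm; apply: (separates_junction Fl crl); rewrite orbA out.
exists m; split.
- by rewrite -hzm; apply: (separates_junction Fl crl); rewrite orbA out.
- rewrite -hzm; apply: (separates_junction Gr); last by rewrite orbA out.
  by rewrite -bB2; case: (B2) B2nil => //= ? ? _; exact: mem_last.
have -> : b = head m (rev B2).
  by rewrite -bB2; case/lastP: (B2) => // ? ?; rewrite last_rcons rev_rcons.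
apply: (separates_junction _ crl).
  rewrite -cat_rcons -rev_cons -rev_cat simple_path_rev -catA.
  by rewrite [(c :: B1) ++ _]cat_cons -BE.
apply/orP; left; case: (B2) (Er B2nil) => //= ? ? ?.
by rewrite rev_cons last_rcons.
Qed.
End Polytree.

(** * Comparison of the partial correlations *)

Section FourCorrelations.
Variable R : realFieldType.
Implicit Types r s al ga be p q t : R.

(* [r], [s], [al], [ga], [be] are the correlations of ac, cb, az, cz, bz; that
   of ab is [r * s]. *)
Definition pcor_b r s : R := (r - r * s * s) ^+ 2 /
  ((1 - (r * s) * (r * s)) * (1 - s * s)).

(* A residual covariance given b and z, up to standard deviations: the fractions
   come from the inverse of the correlation matrix of (b, z). *)
Definition pcov_bz ub uz vb vz be uv : R :=
  uv - ((ub - uz * be) / (1 - be * be) * vb + (uz - ub * be) / (1 - be * be) * vz).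

Definition pcor_bz r s al ga be : R :=
  pcov_bz (r * s) al s ga be r ^+ 2 /
  (pcov_bz (r * s) al (r * s) al be 1 * pcov_bz s ga s ga be 1).

Lemma pcov_bzE ub uz vb vz be uv : 0 < 1 - be * be ->
  pcov_bz ub uz vb vz be uv = (uv * (1 - be * be) -
    ((ub - uz * be) * vb + (uz - ub * be) * vz)) / (1 - be * be).
Proof. by move=> D0; rewrite /pcov_bz; field; rewrite gt_eqF. Qed.

(** The factor [1 - be * be] clears every fraction and cancels in the quotient. [Da] and [Dc] are
    the determinants of the correlation matrices of (a, b, z) and (c, b, z). *)
Lemma pcor_bzE r s al ga be : 0 < 1 - be * be ->
    0 < pcov_bz (r * s) al (r * s) al be 1 -> 0 < pcov_bz s ga s ga be 1 ->
  let Da := 1 - be * be - ((r * s - al * be) * (r * s) + (al - r * s * be) * al) in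
  let Dc := 1 - be * be - ((s - ga * be) * s + (ga - s * be) * ga) in
  let N := r * (1 - be * be) - ((r * s - al * be) * s + (al - r * s * be) * ga) in
  [/\ 0 < Da, 0 < Dc & pcor_bz r s al ga be = N ^+ 2 / (Da * Dc)].
Proof.
move=> D0; rewrite /pcor_bz !pcov_bzE // !mul1r.
rewrite !pmulr_lgt0 ?invr_gt0 //.
move: (1 - be * be) D0 => D D0.
move: (D - _) => Da; move: (D - _) => Dc; move: (r * D - _) => N Da0 Dc0.
by split=> //; field; rewrite !gt_eqF.
Qed.

Lemma pcor_bE r s : 0 < 1 - s * s -> 0 < 1 - (r * s) * (r * s) ->
  pcor_b r s = r ^+ 2 * (1 - s * s) / (1 - (r * s) * (r * s)).
Proof. by move=> s1 rs1; rewrite /pcor_b; field; rewrite !gt_eqF. Qed.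

(** Here [p], [q], [t] are the correlations of the separating vertex with [a], [c], [z]. The
    cross-multiplied difference is a square times a sum of two nonnegative terms. *)
Lemma pcor_common_cause p q t s :
  let r := p * q in let al := p * t in let ga := q * t in let be := s * ga in
    0 < 1 - be * be ->
    0 < pcov_bz (r * s) al (r * s) al be 1 -> 0 < pcov_bz s ga s ga be 1 ->
    0 < 1 - s * s -> 0 < 1 - r * r -> 0 < 1 - al * al -> 0 < 1 - ga * ga ->
    0 <= 1 - p * p -> 0 <= 1 - q * q -> 0 <= 1 - t * t ->
    0 < 1 - (r * s) * (r * s) ->
  pcor_bz r s al ga be <> pcor_b r s ->
  al != 0 /\ pcor_bz r s al ga be < pcor_b r s.
Proof.
move=> r al ga be D0 Da0 Dc0 s1 r1 al1 ga1 p1 q1 t1 rs1.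
have [{}Da0 {}Dc0 ->] := pcor_bzE D0 Da0 Dc0.
rewrite pcor_bE //.
set Da := (X in _ / (X * _)) in Da0 *; set Dc := (X in _ / (_ * X)) in Dc0 *.
pose K := (1 - t * t) * (1 - (r * s) * (r * s)) +
          t * t * (1 - p * p) * (1 - (q * s) * (q * s)).
have DaE : Da = K by rewrite /Da /K /be /al /ga /r; ring.
have DcE : Dc = (1 - ga * ga) * (1 - s * s) by rewrite /Dc /be /ga; ring.
rewrite [X in X ^+ 2](_ : _ = r * ((1 - t * t) * (1 - s * s))); last first.
  by rewrite /be /al /ga /r; ring.
have {}Da0 : 0 < K by rewrite -DaE.
rewrite {}DaE {}DcE in Dc0 *; move=> neq.
(* [al = 0] forces [p = 0], which makes both sides zero, or [t = 0], which makes [z] uninformative;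
   the two sides would agree. *)
have al0 : al != 0.
  apply/eqP => /eqP; rewrite mulf_eq0 => /orP[] /eqP e; apply: neq.
    by rewrite /r e !mul0r !expr0n /= !mul0r.
  rewrite /K /ga e !mulr0 !mul0r !subr0 !addr0; field.
  by rewrite !gt_eqF.
split=> //.
rewrite ltr_pdivrMr ?mulr_gt0 // [ltRHS]mulrAC ltr_pdivlMr //.
have r0 : r != 0.
  apply/eqP => r0; apply: neq; rewrite r0 !mul0r !expr0n /= !mul0r.
  done.
rewrite -subr_gt0.
have -> : r ^+ 2 * (1 - s * s) * (K * ((1 - ga * ga) * (1 - s * s))) -
    (r * ((1 - t * t) * (1 - s * s))) ^+ 2 * (1 - r * s * (r * s)) =
  (r * (1 - s * s) * t) ^+ 2 *
  ((1 - q * q) * (1 - t * t) * (1 - r * s * (r * s)) +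
   (1 - ga * ga) * (1 - p * p) * (1 - (q * s) * (q * s))).
  by rewrite /K /ga /r; ring.
have t0 : t != 0 by apply: contra_neq al0; rewrite /al => ->; rewrite mulr0.
apply: mulr_gt0.
  by rewrite exprn_even_gt0 //; exact: mulf_neq0 (mulf_neq0 r0 (lt0r_neq0 s1)) t0.
have qs1 : 0 < 1 - (q * s) * (q * s) by nra.
(* Both summands vanish only if [p * p = 1] together with [q * q = 1] or [t * t = 1]; this would
   give [r * r = 1] or [al * al = 1]. *)
rewrite lt_def; apply/andP; split; last first.
  by rewrite addr_ge0 // !mulr_ge0 // ltW.
rewrite paddr_eq0 ?mulr_ge0 ?(ltW rs1) ?(ltW qs1) ?(ltW ga1) //.
rewrite !mulf_eq0 (gt_eqF rs1) (gt_eqF qs1) (gt_eqF ga1) !orbF /=.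
apply/negP => /andP[/orP[] /eqP e /eqP p1'].
- have rE : 1 - r * r = 1 - p * p + p * p * (1 - q * q) by rewrite /r; ring.
  by move: r1; rewrite rE e p1' mulr0 addr0 ltxx.
- have alE : 1 - al * al = 1 - p * p + p * p * (1 - t * t) by rewrite /al; ring.
  by move: al1; rewrite alE e p1' mulr0 addr0 ltxx.
Qed.

(** With [al = 0] and [be = s * ga], the numerator is the one without [z], up to the cancelled
    factor, while the residual variance of [a] also loses [be * be]. This raises the quotient. *)
Lemma pcor_collider r s ga :
  let be := s * ga in
    0 < 1 - be * be ->
    0 < pcov_bz (r * s) 0 (r * s) 0 be 1 -> 0 < pcov_bz s ga s ga be 1 ->
    0 < 1 - s * s -> 0 < 1 - ga * ga -> 0 < 1 - (r * s) * (r * s) ->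
  pcor_bz r s 0 ga be <> pcor_b r s ->
  ga != 0 /\ pcor_b r s < pcor_bz r s 0 ga be.
Proof.
move=> be D0 Da0 Dc0 s1 ga1 rs1.
have [{}Da0 {}Dc0 ->] := pcor_bzE D0 Da0 Dc0.
rewrite pcor_bE //.
set Da := (X in _ / (X * _)) in Da0 *; set Dc := (X in _ / (_ * X)) in Dc0 *.
have DaE : Da = 1 - (r * s) * (r * s) - be * be by rewrite /Da /be; ring.
have DcE : Dc = (1 - ga * ga) * (1 - s * s) by rewrite /Dc /be; ring.
rewrite [X in X ^+ 2](_ : _ = r * (1 - s * s)); last by rewrite /be; ring.
have {}Da0 : 0 < 1 - r * s * (r * s) - be * be by rewrite -DaE.
rewrite {}DaE {}DcE in Dc0 *; move=> neq.
have ga0 : ga != 0.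
  apply/eqP => e; apply: neq; rewrite /be e !mulr0 !subr0; field.
  by rewrite !gt_eqF.
split=> //.
have r0 : r != 0.
  by apply/eqP => r0; apply: neq; rewrite r0 !mul0r !expr0n /= !mul0r.
rewrite ltr_pdivrMr // [ltRHS]mulrAC ltr_pdivlMr ?mulr_gt0 // -subr_gt0.
have -> : (r * (1 - s * s)) ^+ 2 * (1 - r * s * (r * s)) -
    r ^+ 2 * (1 - s * s) * ((1 - r * s * (r * s) - be * be) *
      ((1 - ga * ga) * (1 - s * s))) =
  (r * (1 - s * s) * ga) ^+ 2 * (1 - (r * s) * (r * s) + s * s * (1 - ga * ga)).
  by rewrite /be; ring.
apply: mulr_gt0.
  by rewrite exprn_even_gt0 //; exact: mulf_neq0 (mulf_neq0 r0 (lt0r_neq0 s1)) ga0.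
by rewrite ltr_pwDl // mulr_ge0 ?(ltW ga1) // -expr2 sqr_ge0.
Qed.

(** Since [al = r * ga], the numerator is [r * Dc] and the quotient reduces to [r ^+ 2 * Dc / Da].
    The quantity [ga - s * be] is, up to scale, the residual covariance of [c] and [z] given [b]; if
    it vanished, [z] would add nothing. *)
Lemma pcor_chain r s ga be :
  let al := r * ga in
    0 < 1 - be * be ->
    0 < pcov_bz (r * s) al (r * s) al be 1 -> 0 < pcov_bz s ga s ga be 1 ->
    0 < 1 - s * s -> 0 < 1 - r * r -> 0 < 1 - (r * s) * (r * s) ->
  pcor_bz r s al ga be <> pcor_b r s ->
  [/\ r != 0, ga - s * be != 0 & pcor_bz r s al ga be < pcor_b r s].
Proof.
move=> al D0 Da0 Dc0 s1 r1 rs1.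
have [{}Da0 {}Dc0 ->] := pcor_bzE D0 Da0 Dc0.
rewrite pcor_bE //.
set Da := (X in _ / (X * _)) in Da0 *; set Dc := (X in _ / (_ * X)) in Dc0 *.
have DaE : Da = (1 - r * r) * (1 - be * be) + r ^+ 2 * Dc.
  by rewrite /Da /Dc /al; ring.
have DcE : Dc = (1 - s * s) * (1 - be * be) - (ga - s * be) ^+ 2.
  by rewrite /Dc; ring.
rewrite [X in X ^+ 2](_ : _ = r * Dc); last by rewrite /al /Dc; ring.
have {}Da0 : 0 < (1 - r * r) * (1 - be * be) + r ^+ 2 * Dc by rewrite -DaE.
have {}Dc0 : 0 < Dc by [].
rewrite {}DaE; move: Dc => Dc in Dc0 DcE Da0 *.
move=> neq.
have r0 : r != 0.
  by apply/eqP => r0; apply: neq; rewrite r0 !mul0r !expr0n /= !mul0r.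
have g0 : ga - s * be != 0.
  apply/eqP => e; apply: neq; move: Da0 Dc0.
  rewrite DcE e expr0n subr0 => _ _.
  have -> : (1 - r * r) * (1 - be * be) + r ^+ 2 * ((1 - s * s) * (1 - be * be)) =
    (1 - r * s * (r * s)) * (1 - be * be) by ring.
  by field; rewrite !gt_eqF.
split=> //.
rewrite ltr_pdivrMr ?mulr_gt0 // [ltRHS]mulrAC ltr_pdivlMr // -subr_gt0.
have -> : r ^+ 2 * (1 - s * s) * (((1 - r * r) * (1 - be * be) + r ^+ 2 * Dc) * Dc)
   - (r * Dc) ^+ 2 * (1 - r * s * (r * s)) =
  r ^+ 2 * Dc * ((1 - r * r) * (ga - s * be) ^+ 2).
  have -> : (ga - s * be) ^+ 2 = (1 - s * s) * (1 - be * be) - Dc by rewrite DcE; ring.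
  by ring.
have sqr_gt0 (x : R) : x != 0 -> 0 < x ^+ 2 by move=> x0; rewrite exprn_even_gt0.
exact: mulr_gt0 (mulr_gt0 (sqr_gt0 _ r0) Dc0) (mulr_gt0 r1 (sqr_gt0 _ g0)).
Qed.

End FourCorrelations.

(** * Covariances and correlations *)

Section PositiveDefinite.
Variables (R : realType) (V : finType) (S : V -> V -> R).
Hypothesis posS : positive_definite S.
Implicit Types (u v w : V) (Z : {set V}) (s t : V -> R).

Definition cov s t : R := \sum_u \sum_v s u * S u v * t v.

Definition basis u : V -> R := fun v => (v == u)%:R.

Lemma sum_basis u (F : V -> R) : \sum_v basis u v * F v = F u.
Proof.
rewrite (bigD1 u) //= /basis eqxx mul1r big1 ?addr0 // => v /negPf ->.
by rewrite mul0r.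
Qed.

Lemma covC s t : cov s t = cov t s.
Proof.
rewrite /cov exchange_big; apply: eq_bigr => u _; apply: eq_bigr => v _.
by rewrite (posS.1 v u); ring.
Qed.

Lemma cov_linear r s s' t : cov (fun v => s v + r * s' v) t = cov s t + r * cov s' t.
Proof.
rewrite /cov mulr_sumr -big_split /=; apply: eq_bigr => u _.
by rewrite mulr_sumr -big_split /=; apply: eq_bigr => v _; ring.
Qed.

Lemma cov_basisl u t : cov (basis u) t = \sum_v S u v * t v.
Proof.
rewrite /cov -[RHS](sum_basis u (fun w => \sum_v S w v * t v)).
by apply: eq_bigr => w _; rewrite mulr_sumr; apply: eq_bigr => v _; rewrite mulrA.
Qed.

Lemma cov_basis u v : cov (basis u) (basis v) = S u v.
Proof. by rewrite cov_basisl; under eq_bigr do rewrite mulrC; rewrite sum_basis. Qed.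

Lemma basis_neq0 u : exists v, basis u v != 0.
Proof. by exists u; rewrite /basis eqxx oner_eq0. Qed.

Lemma cov_gt0 t : (exists v, t v != 0) -> 0 < cov t t.
Proof. exact: posS.2. Qed.

Lemma variance_gt0 u : 0 < S u u.
Proof. by rewrite -cov_basis; apply: cov_gt0; exact: basis_neq0. Qed.

Lemma cov_block_unit Z : cov_block S Z Z \in unitmx.
Proof.
rewrite unitmxE unitfE; apply/negP => /det0P[y y0 yS].
(* A kernel vector of the block, extended by zero outside [Z], would have variance zero. *)
pose t v := \sum_i basis (enum_val i) v * y 0 i.
have sumt (F : V -> R) : \sum_v t v * F v = \sum_i y 0 i * F (enum_val i).
  under eq_bigr do rewrite mulr_suml; rewrite exchange_big /=. apply: eq_bigr => i _.
  under eq_bigr do rewrite -mulrA; rewrite sum_basis //.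
have : 0 < cov t t.
  apply: cov_gt0; have [i yi] : exists i, y 0 i != 0.
    by move/rV0Pn: y0.
  exists (enum_val i); rewrite /t (bigD1 i) //= big1 ?addr0 => [|j ji].
    by rewrite /basis eqxx mul1r.
  by rewrite /basis (inj_eq enum_val_inj) eq_sym (negPf ji) mul0r.
rewrite /cov.
under eq_bigr => u _ do (under eq_bigr do rewrite -mulrA; rewrite -mulr_sumr).
rewrite sumt.
under eq_bigr => i _ do (under eq_bigr do rewrite mulrC; rewrite sumt mulr_sumr).
rewrite exchange_big /= big1 ?ltxx // => j _.
have /matrixP/(_ 0 j) := yS; rewrite !mxE => e.
transitivity (y 0 j * \sum_i y 0 i * S (enum_val i) (enum_val j)).
  by rewrite mulr_sumr; apply: eq_bigr => i _; ring.
rewrite [X in _ * X](_ : _ = 0) ?mulr0 // -[RHS]e.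
by apply: eq_bigr => i _; rewrite mxE.
Qed.

(** [x] solves the normal equations of the regression of [u] on [Z]. Exhibiting a solution replaces
    the computation of an inverse matrix. *)
Lemma partial_covE u v Z (x : V -> R) :
  (forall w, w \in Z -> \sum_(t in Z) x t * S t w = S u w) ->
  partial_cov S u v Z = S u v - \sum_(t in Z) x t * S t v.
Proof.
move=> xS; rewrite /partial_cov; congr (_ - _).
pose xr : 'rV[R]_#|Z| := \row_i x (enum_val i).
pose ur : 'rV[R]_#|Z| := \row_i S u (enum_val i).
have e : ur *m invmx (cov_block S Z Z) = xr.
  rewrite -[RHS](mulmxK (cov_block_unit Z)); congr (_ *m _).
  apply/rowP => j; rewrite !mxE -(xS _ (enum_valP j)) big_enum_val.
  by apply: eq_bigr => i _; rewrite !mxE.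
rewrite exchange_big /= [RHS]big_enum_val; apply: eq_bigr => j _.
rewrite -mulr_suml; congr (_ * _).
have /rowP/(_ j) := e; rewrite !mxE => <-.
by apply: eq_bigr => i _; rewrite mxE.
Qed.

Lemma partial_cov_gt0 u Z (x : V -> R) : u \notin Z ->
  (forall w, w \in Z -> \sum_(t in Z) x t * S t w = S u w) ->
  0 < partial_cov S u u Z.
Proof.
move=> uZ xS; pose t v := basis u v - (if v \in Z then x v else 0).
have tu : t u = 1 by rewrite /t /basis eqxx (negPf uZ) subr0.
have := cov_gt0 (ex_intro (fun v => t v != 0) u _); rewrite tu => /(_ (oner_neq0 _)).
(* [g v] is the covariance of the regression residual [t] with [v]. It vanishes on [Z], and [t] is
   supported on [u] and [Z], so only the term at [u] survives. *)
pose g v := S u v - \sum_(w in Z) x w * S w v.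
have -> : cov t t = \sum_v g v * t v.
  rewrite /cov exchange_big /=; apply: eq_bigr => v _; rewrite -mulr_suml.
  congr (_ * _); rewrite /g /t.
  under eq_bigr do rewrite mulrBl; rewrite big_split /= sumrN sum_basis.
  congr (_ - _); rewrite [RHS]big_mkcond; apply: eq_bigr => w _.
  by case: ifP; rewrite ?mul0r.
rewrite (bigD1 u) //= tu mulr1 big1 ?addr0 => [|v vu].
  by rewrite (partial_covE u xS).
rewrite /t /basis (negPf vu) sub0r; case: ifP => [vZ|]; last by rewrite oppr0 mulr0.
by rewrite /g xS // subrr mul0r.
Qed.

Definition stddev u : R := Num.sqrt (S u u).

Definition corr u v : R := S u v / (stddev u * stddev v).

Lemma stddev_gt0 u : 0 < stddev u.
Proof. by rewrite sqrtr_gt0 variance_gt0. Qed.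

Lemma sqr_stddev u : stddev u ^+ 2 = S u u.
Proof. exact: (sqr_sqrtr (ltW (variance_gt0 u))). Qed.

Lemma covE u v : S u v = stddev u * stddev v * corr u v.
Proof. by rewrite /corr; field; rewrite !gt_eqF ?stddev_gt0. Qed.

Lemma corrC u v : corr u v = corr v u.
Proof. by rewrite /corr (posS.1 u v) [X in _ / X]mulrC. Qed.

Lemma corrxx u : corr u u = 1.
Proof. by rewrite /corr -expr2 sqr_stddev divff // gt_eqF ?variance_gt0. Qed.

Lemma corr_eq0 u v : (corr u v == 0) = (S u v == 0).
Proof. by rewrite [in RHS]covE !mulf_eq0 !(gt_eqF (stddev_gt0 _)). Qed.

Lemma corr_chain u v w : S u v * S w w = S u w * S w v ->
  corr u v = corr u w * corr w v.
Proof.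
move=> e; rewrite /corr -[RHS]mulrA.
have -> : S u v = S u w * S w v / S w w by rewrite -e mulfK // gt_eqF ?variance_gt0.
rewrite -(sqr_stddev w).
by field; rewrite !gt_eqF ?stddev_gt0.
Qed.

Lemma partial_cov1 u v b :
  partial_cov S u v [set b]%SET =
    stddev u * stddev v * (corr u v - corr u b * corr b v).
Proof.
rewrite (@partial_covE u v _ (fun=> stddev u / stddev b * corr u b)).
  rewrite big_set1 (covE u v) (covE b v); field.
  by rewrite gt_eqF ?stddev_gt0.
move=> w; rewrite inE => /eqP ->; rewrite big_set1 (covE u b) (covE b b) corrxx.
by field; rewrite gt_eqF ?stddev_gt0.
Qed.

(** Up to the variance of [u], this is the residual variance of [u] given [v]. *)
Lemma corr_lt1 u v : u != v -> 0 < 1 - corr u v * corr u v.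
Proof.
move=> uv; have : 0 < partial_cov S u u [set v]%SET.
  apply: (@partial_cov_gt0 u _ (fun=> S u v / S v v)); first by rewrite inE.
  by move=> w; rewrite inE => /eqP ->; rewrite big_set1 divfK // gt_eqF ?variance_gt0.
by rewrite partial_cov1 corrxx (corrC v u) pmulr_rgt0 // mulr_gt0 ?stddev_gt0.
Qed.

Lemma corr_le1 u v : 0 <= 1 - corr u v * corr u v.
Proof.
by have [->|/corr_lt1/ltW//] := eqVneq u v; rewrite corrxx mulr1 subrr.
Qed.

Lemma sq_partial_corr1 a b c : a != b -> c != b ->
  corr a b = corr a c * corr c b ->
  sq_partial_corr S a c [set b]%SET = pcor_b (corr a c) (corr c b).
Proof.
move=> ab cb abE; have := corr_lt1 ab; have := corr_lt1 cb.
rewrite /sq_partial_corr !partial_cov1 /pcor_b !corrxx (corrC b c) (corrC b a) abE.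
by move=> h1 h2; field; rewrite !gt_eqF ?stddev_gt0.
Qed.

(** * Conditioning on two variables *)

Section TwoConditioned.
Variables b z : V.
Hypothesis bz : b != z.

Let D0 : 0 < 1 - corr b z * corr b z. Proof. exact: corr_lt1. Qed.

(** Cramer's solution of the two normal equations, written in standardized variables and scaled
    back. *)
Let coef u w : R := stddev u / stddev w *
  (if w == b then (corr u b - corr u z * corr b z) / (1 - corr b z * corr b z)
   else (corr u z - corr u b * corr b z) / (1 - corr b z * corr b z)).

Let sum_pair (F : V -> R) : \sum_(t in [set b; z]%SET) F t = F b + F z.
Proof. by rewrite big_setU1 ?inE //= big_set1. Qed.

Let coefP u w : w \in [set b; z]%SET ->
  \sum_(t in [set b; z]%SET) coef u t * S t w = S u w.
Proof.
rewrite sum_pair /coef eqxx eq_sym (negPf bz) !inE => /orP[] /eqP ->.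
  rewrite (covE b b) (covE z b) (covE u b) (corrC z b) corrxx; field.
  by rewrite !gt_eqF ?stddev_gt0.
rewrite (covE z z) (covE b z) (covE u z) corrxx; field.
by rewrite !gt_eqF ?stddev_gt0.
Qed.

Lemma partial_cov2 u v : partial_cov S u v [set b; z]%SET =
  stddev u * stddev v *
  pcov_bz (corr u b) (corr u z) (corr v b) (corr v z) (corr b z) (corr u v).
Proof.
rewrite (partial_covE _ (coefP u)) sum_pair /coef eqxx eq_sym (negPf bz).
rewrite (covE b v) (covE z v) (covE u v) (corrC b v) (corrC z v) /pcov_bz; field.
by rewrite !gt_eqF ?stddev_gt0.
Qed.

Lemma pcov_bz_gt0 u : u != b -> u != z ->
  0 < pcov_bz (corr u b) (corr u z) (corr u b) (corr u z) (corr b z) 1.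
Proof.
move=> ub uz; have : 0 < partial_cov S u u [set b; z]%SET.
  by apply: (partial_cov_gt0 _ (coefP u)); rewrite !inE negb_or ub.
by rewrite partial_cov2 corrxx pmulr_rgt0 // mulr_gt0 ?stddev_gt0.
Qed.

Lemma sq_partial_corr2 a c : a != b -> a != z -> c != b -> c != z ->
  corr a b = corr a c * corr c b ->
  sq_partial_corr S a c [set b; z]%SET =
    pcor_bz (corr a c) (corr c b) (corr a z) (corr c z) (corr b z).
Proof.
move=> ab az cb cz abE; have := pcov_bz_gt0 ab az; have := pcov_bz_gt0 cb cz.
rewrite /sq_partial_corr !partial_cov2 /pcor_bz !corrxx abE => h1 h2.
move: (pcov_bz _ _ _ _ _ _) h1; move: (pcov_bz _ _ _ _ _ _) h2 => x ? y ?.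
move: (pcov_bz _ _ _ _ _ _) => w.
by field; rewrite !gt_eqF ?stddev_gt0.
Qed.

End TwoConditioned.
End PositiveDefinite.

Arguments basis {R V} u v.

(** * Integrals over events *)

Section RealExpectation.
Import HBSimple HBNNSimple.
Context d (T : measurableType d) (R : realType) (P : probability T R).
Local Open Scope classical_set_scope.
Implicit Types (f g h Y : T -> R) (A : set T).

Notation integ f := (P.-integrable setT (EFin \o f)).
Notation Ex f := (Rintegral P setT f).

Lemma integrable_measurable f : integ f -> measurable_fun setT f.
Proof. by move=> /integrableP[/measurable_EFinP]. Qed.

Lemma integrable_le f g : measurable_fun setT f ->
  (forall x, `|f x| <= `|g x|) -> integ g -> integ f.
Proof.
move=> mf fg; apply: le_integrable => //; first exact/measurable_EFinP.
by move=> x _; rewrite /= lee_fin.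
Qed.

Lemma integrable_mul_bounded f g (M : R) : integ f -> measurable_fun setT g ->
  (forall x, `|g x| <= M) -> integ (fun x => f x * g x).
Proof.
move=> intf mg gM; have M0 : 0 <= M by rewrite (le_trans _ (gM point)).
apply: (@integrable_le _ (fun x => M * f x)).
- by apply: measurable_funM => //; exact: integrable_measurable.
- by move=> x; rewrite !normrM mulrC ler_wpM2r // (ger0_norm M0).
- exact: (integrableZl _ M intf).
Qed.

Lemma integrable_mul_indic f A : integ f -> measurable A ->
  integ (fun x => f x * \1_A x).
Proof.
move=> intf mA; apply: (@integrable_mul_bounded _ _ 1) => //.
by move=> x; rewrite indicE ger0_norm //; case: (_ \in _).
Qed.

Lemma integrable_lin f g r : integ f -> integ g ->
  integ (fun x => f x + r * g x).
Proof. by move=> intf intg; exact: (integrableD _ intf (integrableZl _ r intg)). Qed.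

Lemma Rintegral_probability_cst r : Ex (cst r) = r.
Proof.
by rewrite Rintegral_cst // [X in _ * fine X](probability_setT P) mulr1.
Qed.

Lemma expectation_lin f g r : integ f -> integ g ->
  Ex (fun x => f x + r * g x) = Ex f + r * Ex g.
Proof.
move=> intf intg; rewrite RintegralD // ?RintegralZl //.
exact: (integrableZl _ r intg).
Qed.

(** Dominated convergence for vanishing integrals; it serves simple functions, difference quotients
    and countable unions. *)
Lemma expectation_limit0 (f_ : nat -> T -> R) f g :
  (forall n, measurable_fun setT (f_ n)) -> measurable_fun setT f ->
  (forall x, f_ ^~ x @ \oo --> f x) -> integ g ->
  (forall n x, `|f_ n x| <= g x) -> (forall n, Ex (f_ n) = 0) ->
  integ f /\ Ex f = 0.
Proof.
move=> mf_ mf f_f intg f_g f_0.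
have f_fE x : (EFin \o f_ ^~ x) @ \oo --> (f x)%:E.
  exact: (cvg_comp _ _ (f_f x)).
have [//||||| intf _ cvgf] := @dominated_convergence _ _ _ P setT measurableT
   (fun n => EFin \o f_ n) (EFin \o f) (EFin \o g).
- by move=> n; exact/measurable_EFinP.
- exact/measurable_EFinP.
- by apply: aeW => x _; exact: f_fE.
- by [].
- by apply: aeW => x n _; rewrite /= lee_fin.
split=> //.
have intf_ n : integ (f_ n).
  apply: integrable_le intg => // x.
  by rewrite (le_trans (f_g n x)) // ler_norm.
have e0 : [sequence \int[P]_x (EFin \o f_ n) x]_n%E = cst 0%E.
  apply/funext => n /=; rewrite -[LHS]fineK.
  2: by apply: integrable_fin_num => //; exact: intf_.
  by congr (_%:E); exact: f_0.
rewrite e0 in cvgf; move/cvg_lim : cvgf => /(_ (@ereal_hausdorff _)).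
by rewrite lim_cst // /Rintegral => <-.
Qed.

Lemma expectation_mul_indic_null f (N : set T) : integ f -> measurable N ->
  P N = 0%E -> Ex (fun x => f x * \1_N x) = 0.
Proof.
move=> intf mN N0.
have -> : (fun x => f x * \1_N x) = f \_ N.
  by apply/funext => x; rewrite patch_indic.
rewrite -Rintegral_mkcond /Rintegral (null_set_integral mN) //.
exact/measurable_EFinP/measurable_funTS/(integrable_measurable intf).
Qed.

Lemma expectation_ge0_eq0 f : integ f -> (forall x, 0 <= f x) -> Ex f = 0 ->
  {ae P, forall x, f x = 0}.
Proof.
move=> intf f0 Ef0; have mf := integrable_measurable intf.
have : (\int[P]_x `|(f x)%:E| = 0)%E.
  under eq_integral do rewrite gee0_abs ?lee_fin //.
  by rewrite -[LHS]fineK ?integrable_fin_num // [fine _]Ef0.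
move/(ae_eq_integral_abs _ measurableT ((measurable_EFinP _ _).2 mf)).
by apply: filterS => x /(_ I) [].
Qed.

Lemma sum_indic (phi : {nnsfun (measurableTypeR R) >-> R}) y :
  phi y = \sum_(r <- fset_set (range phi)) r * \1_(phi @^-1` [set r]) y.
Proof. by rewrite {1}fimfunE fsbig_finite. Qed.

Lemma expectation_sum0 (I : Type) (s : seq I) (F : I -> T -> R) :
  (forall i, integ (F i)) -> (forall i, Ex (F i) = 0) ->
  integ (fun x => \sum_(i <- s) F i x) /\ Ex (fun x => \sum_(i <- s) F i x) = 0.
Proof.
move=> intF F0; elim: s => [|i s [intS S0]].
  have -> : (fun x => \sum_(i <- [::]) F i x) = cst 0.
    by apply/funext => x; rewrite big_nil.
  by split; [exact: integrable0|rewrite Rintegral_cst // mul0r].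
have -> : (fun x => \sum_(i <- i :: s) F i x) =
    (fun x => F i x + 1 * \sum_(i <- s) F i x).
  by apply/funext => x; rewrite big_cons mul1r.
by split; [exact: integrable_lin|rewrite expectation_lin // F0 S0 mulr0 addr0].
Qed.

(* The positive part of [Y] is a limit of simple functions of [Y]. *)
Lemma expectation_mul_eq0_pos Y h :
  measurable_fun setT Y -> integ h -> integ (fun x => Y x * h x) ->
  (forall B : set R, measurable B -> Ex (fun x => h x * \1_(Y @^-1` B) x) = 0) ->
  integ (fun x => Num.max (Y x) 0 * h x) /\
  Ex (fun x => Num.max (Y x) 0 * h x) = 0.
Proof.
move=> mY inth intYh h0.
have mpos : measurable_fun setT (fun y : measurableTypeR R => (Num.max y 0)%:E).
  apply/measurable_EFinP.
  apply: (measurable_maxr (@measurable_id _ _ setT)).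
  exact: (@measurable_cst _ _ _ _ setT (0 : R)).
have pos0 (y : measurableTypeR R) : setT y -> (0 <= (Num.max y 0)%:E)%E.
  by move=> _; rewrite lee_fin le_max lexx orbT.
pose phi n := nnsfun_approx measurableT mpos n.
have mh := integrable_measurable inth.
have mphi n : measurable_fun setT (fun x => phi n (Y x) * h x).
  apply: measurable_funM => //.
  exact: (measurableT_comp (measurable_funPT (phi n)) mY).
(* The approximations stay below the positive part of [Y], hence the dominating function. Each is a
   finite combination of indicators of events of [Y]. *)
apply: (@expectation_limit0 (fun n x => phi n (Y x) * h x) _ (fun x => `|Y x * h x|)).
- exact: mphi.
- apply: measurable_funM => //.
  exact: (measurable_maxr mY (@measurable_cst _ _ _ _ setT (0 : R))).
- move=> x; apply: cvgMl.
  have := cvg_nnsfun_approx measurableT mpos pos0 (I : setT (Y x)).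
  by move/fine_cvgP => [].
- by have := integrable_norm intYh.
- move=> n x; rewrite !normrM ler_wpM2r //.
  have := le_approx n pos0 (I : setT (Y x)).
  rewrite -nnsfun_approxE lee_fin -/(phi n) => phiY.
  rewrite ger0_norm; last exact: fun_ge0.
  by rewrite (le_trans phiY) // ge_max ler_norm normr_ge0.
- move=> n.
  have -> : (fun x => phi n (Y x) * h x) = (fun x =>
     \sum_(r <- fset_set (range (phi n)))
        (r * (h x * \1_(Y @^-1` (phi n @^-1` [set r])) x))).
    apply/funext => x; rewrite sum_indic mulr_suml; apply: eq_bigr => r _.
    by rewrite -mulrA [X in _ * X]mulrC.
  have mA r : measurable (Y @^-1` (phi n @^-1` [set r])).
    rewrite -[X in measurable X]setTI; apply: mY => //.
    by rewrite -[X in measurable X]setTI; exact: (measurable_funPT (phi n)).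
  have inthA r := integrable_mul_indic inth (mA r).
  apply: (proj2 (@expectation_sum0 _ _
    (fun r x => r * (h x * \1_(Y @^-1` (phi n @^-1` [set r])) x)) _ _)) => r.
    exact: (integrableZl _ r (inthA r)).
  rewrite RintegralZl //.
  rewrite h0 ?mulr0 //.
  by rewrite -[X in measurable X]setTI; exact: (measurable_funPT (phi n)).
Qed.

(** Orthogonality to the events of [Y] passes to [Y] itself, by treating the positive parts of [Y]
    and of its opposite separately. *)
Lemma expectation_mul_eq0 Y h :
  measurable_fun setT Y -> integ h -> integ (fun x => Y x * h x) ->
  (forall B : set R, measurable B -> Ex (fun x => h x * \1_(Y @^-1` B) x) = 0) ->
  Ex (fun x => Y x * h x) = 0.
Proof.
move=> mY inth intYh h0.
have [int1 e1] := expectation_mul_eq0_pos mY inth intYh h0.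
have [||B mB|int2 e2] := @expectation_mul_eq0_pos (fun x => - Y x) h _ inth.
- exact: measurable_funN.
- have -> : (fun x => - Y x * h x) = (fun x => - 1 * (Y x * h x)).
    by apply/funext => x; rewrite mulN1r mulNr.
  exact: (integrableZl _ (- 1) intYh).
- apply: (h0 (-%R @^-1` B)); rewrite -[X in measurable X]setTI.
  exact: oppr_measurable.
have -> : (fun x => Y x * h x) =
    (fun x => Num.max (Y x) 0 * h x + (- 1) * (Num.max (- Y x) 0 * h x)).
  apply/funext => x; rewrite mulN1r -mulrBl; congr (_ * _).
  by case: (leP (Y x) 0) => Y0; case: (leP (- Y x) 0) => Y0'; lra.
by rewrite expectation_lin // e1 e2 mulr0 addr0.
Qed.

End RealExpectation.

(** * Normal laws *)

Section NormalLaw.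
Variable R : realType.
Local Open Scope classical_set_scope.
Notation leb := (@lebesgue_measure R).

Lemma measurable_addr (c : R) :
  measurable_fun setT (fun x : measurableTypeR R => x + c : measurableTypeR R).
Proof.
apply: (measurable_funD (@measurable_id _ _ setT)).
exact: (@measurable_cst _ _ _ _ setT c).
Qed.

(** The translated measure has the same values on half-open intervals, and these determine Lebesgue
    measure. *)
Lemma lebesgue_measure_addr (c : R) (A : set (measurableTypeR R)) : measurable A ->
  leb ((fun x => x + c) @^-1` A) = leb A.
Proof.
move=> mA; pose f := fun x : measurableTypeR R => x + c : measurableTypeR R.
pose F : {mfun measurableTypeR R >-> measurableTypeR R} :=
  HB.pack f (isMeasurableFun.Build _ _ _ _ f (measurable_addr c)).
apply/esym; apply: (@lebesgue_measure_unique R (pushforward leb F)) mA.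
move=> _ [[a b] _ <-]; rewrite /pushforward /=.
rewrite [X in _ = leb X](_ : _ = `]a - c, b - c]%classic); last first.
  by apply/seteqP; split=> x /=; rewrite !in_itv /= ltrBlDr lerBrDr.
rewrite !lebesgue_measure_itv /= !lte_fin ltrD2r; case: ifP => // _.
by rewrite -!EFinD; congr (_%:E); ring.
Qed.

Lemma normal_prob_center (m s : R) (A : set (measurableTypeR R)) :
  s != 0 -> measurable A ->
  normal_prob m s A = normal_prob 0 s ((fun x => x + m) @^-1` A).
Proof.
move=> s0 mA; rewrite /normal_prob.
have mpdf : measurable_fun setT (fun x : measurableTypeR R => (normal_pdf m s x)%:E).
  by apply/measurable_EFinP; exact: measurable_normal_pdf.
pose f := fun x : measurableTypeR R => x + m : measurableTypeR R.
pose F : {mfun measurableTypeR R >-> measurableTypeR R} :=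
  HB.pack f (isMeasurableFun.Build _ _ _ _ f (measurable_addr m)).
rewrite (@eq_measure_integral _ _ _ _ (pushforward leb F)); last first.
  by move=> B mB _; exact/esym/(lebesgue_measure_addr m mB).
rewrite ge0_integral_pushforward //=.
- apply: eq_integral => x _; rewrite /= !normal_pdfE // normal_fun_center /=.
  by rewrite /f addrK.
- exact: measurable_addr.
- exact: (measurable_funTS mpdf).
- by move=> y _; rewrite lee_fin normal_pdf_ge0.
Qed.

Lemma normal_prob_set1 (m s x : R) : normal_prob m s [set x] = 0%E.
Proof.
have /null_content_dominatesP dom := normal_prob_dominates m s.
by apply: dom; [exact: measurable_set1|exact: lebesgue_measure_set1].
Qed.

(** Doubling the variance leaves enough Gaussian decay to absorb the factor [|x|], so the first
    moment is finite without being computed. *)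
Lemma normr_normal_pdf_le (s : R) : 0 < s -> exists C : R, forall x,
  `|x| * normal_pdf 0 s x <= C * normal_pdf 0 (Num.sqrt 2 * s) x.
Proof.
move=> s0; have s20 : 0 < Num.sqrt 2 * s by rewrite mulr_gt0 // sqrtr_gt0.
exists (s * normal_peak s / normal_peak (Num.sqrt 2 * s)) => y.
rewrite !normal_pdfE ?gt_eqF // mulrCA -!mulrA mulKf ?gt_eqF ?normal_peak_gt0 ?gt_eqF //.
rewrite [leRHS]mulrCA ler_wpM2l ?normal_peak_ge0 //.
rewrite /normal_fun !subr0 exprMn sqr_sqrtr //.
have -> : - y ^+ 2 / (s ^+ 2 *+ 2) = - (y / (2 * s)) ^+ 2 + - y ^+ 2 / (2 * s ^+ 2 *+ 2).
  by field; rewrite gt_eqF.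
rewrite expRD mulrA ler_wpM2r ?expR_ge0 // expRN.
rewrite ler_pdivrMr ?expR_gt0 //.
(* The exponential is at least one plus its argument; what remains is a completed square. *)
apply: (@le_trans _ _ (s * (1 + (y / (2 * s)) ^+ 2))); last first.
  by rewrite ler_wpM2l ?(ltW s0) // expR_ge1Dx.
have -> : s * (1 + (y / (2 * s)) ^+ 2) = `|y| + s * (1 - `|y| / (2 * s)) ^+ 2.
  rewrite expr_div_n -(real_normK (num_real y)).
  by field; rewrite gt_eqF.
by rewrite lerDl mulr_ge0 ?sqr_ge0 ?ltW.
Qed.

Lemma integral_normr_normal_prob (s : R) : 0 < s ->
  (\int[normal_prob 0 s]_x `|x|%:E < +oo)%E.
Proof.
move=> s0; have [C CE] := normr_normal_pdf_le s0.
have s20 : 0 < Num.sqrt 2 * s by rewrite mulr_gt0 // sqrtr_gt0.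
have mabs : measurable_fun setT (fun x : measurableTypeR R => `|x|%:E).
  by apply/measurable_EFinP; exact: normr_measurable.
have mpdf t : measurable_fun setT (fun x : measurableTypeR R => (normal_pdf 0 t x)%:E).
  by apply/measurable_EFinP; exact: measurable_normal_pdf.
have dom := normal_prob_dominates 0 s.
rewrite -(@Radon_Nikodym_SigmaFinite.change_of_variables _ _ _ (normal_prob 0 s) leb) //.
pose RN := Radon_Nikodym_SigmaFinite.f (normal_prob 0 s) leb.
have intRN : leb.-integrable setT RN := Radon_Nikodym_SigmaFinite.f_integrable dom.
(* The change of variables yields an abstract density, which is identified with the normal one
   almost everywhere. *)
have RNE : ae_eq leb setT RN (fun x => (normal_pdf 0 s x)%:E).
  apply: integral_ae_eq => //.
  by move=> A _ mA; rewrite -Radon_Nikodym_SigmaFinite.f_integral.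
rewrite (ae_eq_integral
  (fun x : measurableTypeR R => `|x|%:E * (normal_pdf 0 s x)%:E)%E) //; last 3 first.
- by apply: emeasurable_funM => //; exact: (measurable_int _ intRN).
- exact: emeasurable_funM.
- by apply: filterS RNE => x e xT; congr (_ * _)%E; exact: e.
apply: (@le_lt_trans _ _ (\int[leb]_x (C%:E * (normal_pdf 0 (Num.sqrt 2 * s) x)%:E))%E).
  apply: ge0_le_integral => //.
  - by move=> x _; rewrite mule_ge0 // lee_fin ?normr_ge0 ?normal_pdf_ge0.
  - exact: emeasurable_funM.
  - exact: emeasurable_funM.
  - by move=> x _; rewrite -!EFinM lee_fin.
rewrite integralZl //; last exact: integrable_normal_pdf.
by rewrite integral_normal_pdf mule1 ltry.
Qed.

End NormalLaw.

(** * Conditional probabilities *)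

Section ConditionalProbability.
Context d (T : measurableType d) (R : realType) (P : probability T R).
Local Open Scope classical_set_scope.
Variable G : set (set T).
Hypothesis measG : G `<=` measurable.
Implicit Types (A B C : set T) (f g Y : T -> R).

Notation integ f := (P.-integrable setT (EFin \o f)).
Notation Ex f := (Rintegral P setT f).

(** Values in the unit interval keep all products with integrable functions integrable. *)
Definition bounded_version A g :=
  [/\ forall S : set R, measurable S -> G (g @^-1` S),
      forall x, 0 <= g x <= 1
    & forall C, G C -> Ex (fun x => g x * \1_C x) = Ex (fun x => \1_A x * \1_C x)].

Lemma measurable_of_preimage g :
  (forall S : set R, measurable S -> G (g @^-1` S)) -> measurable_fun setT g.
Proof. by move=> Gg _ S mS; rewrite setTI; apply: measG; exact: Gg. Qed.

Lemma integrable_unit g : measurable_fun setT g -> (forall x, 0 <= g x <= 1) ->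
  integ g.
Proof.
move=> mg g01; apply: (@integrable_le _ _ _ P _ (cst 1)) => //.
  by move=> x; have /andP[g0 g1] := g01 x; rewrite !ger0_norm.
exact: finite_measure_integrable_cst.
Qed.

Lemma indic_unit A (x : T) : 0 <= (\1_A x : R) <= 1.
Proof. by rewrite indicE; case: (_ \in _); rewrite ?lexx ler01. Qed.

Lemma integrable_mul_unit f g : integ f -> measurable_fun setT g ->
  (forall x, 0 <= g x <= 1) -> integ (fun x => f x * g x).
Proof.
move=> intf mg g01; apply: (@integrable_mul_bounded _ _ _ P _ _ 1) => // x.
by have /andP[g0 g1] := g01 x; rewrite ger0_norm.
Qed.

Lemma expectation_indicI A B : measurable A -> measurable B ->
  Ex (fun x => \1_A x * \1_B x) = fine (P (A `&` B)).
Proof.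
move=> mA mB; rewrite (_ : (fun x => _) = \1_(A `&` B)); last first.
  by apply/funext => x; rewrite indicI.
by rewrite /Rintegral integral_indic ?setIT //; exact: measurableI.
Qed.

Lemma expectation_ae_eq f g : measurable_fun setT f -> measurable_fun setT g ->
  {ae P, forall x, f x = g x} -> Ex f = Ex g.
Proof.
move=> mf mg fg; rewrite /Rintegral; congr fine.
apply: ae_eq_integral => //; [exact/measurable_EFinP..|].
by apply: filterS fg => x ->.
Qed.

Lemma cond_prob_version_expectation A g : measurable A ->
  cond_prob_version P G A g -> integ g /\
  forall C, G C -> Ex (fun x => g x * \1_C x) = Ex (fun x => \1_A x * \1_C x).
Proof.
move=> mA [Gg intg gC]; split=> // C GC.
have mC := measG GC.
rewrite expectation_indicI // -gC //.
rewrite (_ : (fun x => _) = g \_ C); last by apply/funext => x; rewrite patch_indic.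
by rewrite -Rintegral_mkcond.
Qed.

Definition clip (x : R) : R := Num.max 0 (Num.min 1 x).

Lemma measurable_clip : measurable_fun setT clip.
Proof.
apply: (measurable_maxr (@measurable_cst _ _ _ _ setT (0 : R))).
apply: (measurable_minr (@measurable_cst _ _ _ _ setT (1 : R))).
exact: (@measurable_id _ _ setT).
Qed.

Lemma clip_unit x : 0 <= clip x <= 1.
Proof. by rewrite /clip le_max lexx ge_max ler01 ge_min lexx. Qed.

Lemma clip_id x : 0 <= x <= 1 -> clip x = x.
Proof. by move=> /andP[x0 x1]; rewrite /clip min_r // max_r. Qed.

(** The event where [g] exceeds 1 lies in [G], and there the integral of [g] is at most its
    probability, so the nonnegative excess integrates to 0. The event where [g] is negative is
    treated alike. *)
Lemma cond_prob_version_ae_unit A g : measurable A ->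
  cond_prob_version P G A g -> {ae P, forall x, clip (g x) = g x}.
Proof.
move=> mA vg; have [intg gC] := cond_prob_version_expectation mA vg.
have [Gg _ _] := vg.
have Ex01 C : measurable C -> 0 <= Ex (fun x => \1_A x * \1_C x) <= Ex \1_C.
  move=> mC; rewrite expectation_indicI // /Rintegral integral_indic // setIT.
  have mAC := measurableI _ _ mA mC.
  apply/andP; split; first exact: fine_ge0.
  apply: fine_le; [exact: fin_num_measure..|].
  by apply: le_measure; rewrite ?inE //; exact: subIsetr.
have ae1 : {ae P, forall x, (g x - 1) * \1_(g @^-1` `]1, +oo[) x = 0}.
  set C := g @^-1` _; have GC : G C by exact: Gg.
  have mC := measG GC.
  have e x : (g x - 1) * \1_C x = g x * \1_C x + (-1) * \1_C x by ring.
  have int1 : integ (fun x => g x * \1_C x) by exact: integrable_mul_indic.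
  have int2 : integ \1_C by exact: integrable_indic.
  have pos x : 0 <= (g x - 1) * \1_C x.
    rewrite indicE; case: (boolP (x \in C)) => [/set_mem|_]; last by rewrite mulr0.
    by rewrite /C /= in_itv /= andbT mulr1 subr_ge0 => /ltW.
  apply: expectation_ge0_eq0 => //.
    by under eq_fun do rewrite e; exact: integrable_lin.
  apply/eqP; rewrite eq_le Rintegral_ge0 // andbT.
  under eq_Rintegral do rewrite e.
  rewrite expectation_lin // gC // mulN1r subr_le0.
  by have /andP[] := Ex01 C mC.
have ae2 : {ae P, forall x, (-1) * (g x * \1_(g @^-1` `]-oo, 0[) x) = 0}.
  set C := g @^-1` _; have GC : G C by exact: Gg.
  have mC := measG GC.
  have int1 : integ (fun x => g x * \1_C x) by exact: integrable_mul_indic.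
  have pos x : 0 <= (-1) * (g x * \1_C x).
    rewrite indicE; case: (boolP (x \in C)) => [/set_mem|_]; last by rewrite !mulr0.
    by rewrite /C /= in_itv /= mulr1 mulN1r oppr_ge0 => /ltW.
  apply: expectation_ge0_eq0 => //; first exact: (integrableZl _ (-1) int1).
  apply/eqP; rewrite eq_le Rintegral_ge0 // andbT RintegralZl // gC // mulN1r oppr_le0.
  by have /andP[] := Ex01 C mC.
apply: filterS2 ae1 ae2 => x; rewrite !indicE => h1 h2; apply: clip_id.
apply/andP; split; rewrite leNgt; apply/negP => hg.
- move: h2; rewrite mem_set /= ?in_itv //= mulr1; lra.
- move: h1; rewrite mem_set /= ?in_itv /= ?andbT // mulr1; lra.
Qed.

Lemma cond_prob_version_clip A g : measurable A ->
  cond_prob_version P G A g -> bounded_version A (clip \o g).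
Proof.
move=> mA vg; have [Gg _ _] := vg.
have [intg gC] := cond_prob_version_expectation mA vg.
have mg := measurable_of_preimage Gg.
have mcg : measurable_fun setT (clip \o g) by exact: measurableT_comp measurable_clip mg.
split=> [S mS|x|C GC]; [|exact: clip_unit|].
  apply: (Gg (clip @^-1` S)); rewrite -[X in measurable X]setTI.
  exact: measurable_clip.
have mC := measG GC.
have mindic : measurable_fun setT (\1_C : T -> R) by exact: measurable_indic.
rewrite -gC //; apply: expectation_ae_eq; [exact: measurable_funM..|].
by apply: filterS (cond_prob_version_ae_unit mA vg) => x /= ->.
Qed.

(** Clipping changes versions only on null sets; integrating the product version over the whole
    space gives the last identity. *)
Lemma cond_independent_bounded A B : measurable A -> measurable B ->
  (exists f g : T -> R, [/\ cond_prob_version P G A f, cond_prob_version P G B g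
     & cond_prob_version P G (A `&` B) (f \* g)]) ->
  exists f g : T -> R, [/\ bounded_version A f, bounded_version B g
     & Ex (fun x => f x * g x) = Ex (fun x => \1_A x * \1_B x)].
Proof.
move=> mA mB [f [g [vf vg vfg]]]; exists (clip \o f), (clip \o g).
have [bf bg] := (cond_prob_version_clip mA vf, cond_prob_version_clip mB vg).
split=> //.
have mI : measurable (A `&` B) by exact: measurableI.
have [_ _ fgC] := vfg.
have [Gf0 _ _] := vf.
(* [G] is any family of measurable sets here; it contains the whole space as a preimage under
   [f]. *)
have GT : G setT.
  by rewrite -(preimage_setT f); apply: Gf0; exact: measurableT.
rewrite expectation_indicI //; have := fgC _ GT; rewrite setIT => <-.
have [Gf _ _] := bf.
have [Gg _ _] := bg.
apply: expectation_ae_eq.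
- by apply: measurable_funM; [exact: (measurable_of_preimage Gf)|
    exact: (measurable_of_preimage Gg)].
- have [Gg0 _ _] := vg.
  by apply: measurable_funM; [exact: (measurable_of_preimage Gf0)|
    exact: (measurable_of_preimage Gg0)].
- apply: filterS2 (cond_prob_version_ae_unit mA vf)
    (cond_prob_version_ae_unit mB vg) => x /=.
  by move=> -> ->.
Qed.

(** The events of [Y] belong to [G], and over these [g] and the indicator of [B] have equal
    integrals. *)
Lemma bounded_version_orthogonal B g Y : measurable B -> bounded_version B g ->
  integ Y -> (forall S : set R, measurable S -> G (Y @^-1` S)) ->
  Ex (fun x => Y x * (\1_B x - g x)) = 0.
Proof.
move=> mB [Gg g01 gC] intY GY; have mg := measurable_of_preimage Gg.
have mB1 : measurable_fun setT (\1_B : T -> R) by exact: measurable_indic.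
have mh : measurable_fun setT (fun x => \1_B x - g x) by exact: measurable_funB.
have h1 x : `|\1_B x - g x| <= 1.
  rewrite ler_norml; have /andP[] := g01 x; have /andP[] := indic_unit B x.
  by move=> ? ? ? ?; apply/andP; split; lra.
have intg := integrable_unit mg g01.
have intB : integ \1_B by exact: integrable_indic.
apply: expectation_mul_eq0.
- exact: measurable_of_preimage.
- exact: (integrableB measurableT intB intg).
- exact: (integrable_mul_bounded intY mh h1).
move=> S mS; have GS := GY _ mS; have mYS := measG GS.
rewrite (_ : (fun x => _) = (fun x => \1_B x * \1_(Y @^-1` S) x +
   (-1) * (g x * \1_(Y @^-1` S) x))); last by apply/funext => x; ring.
rewrite expectation_lin; [|exact: integrable_mul_indic..].
by rewrite gC // mulN1r subrr.
Qed.

(* The version [g] need not be the one paired with [f]: both versions of B have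
   the same integral against [f], hence against the indicator of A. *)
Lemma cond_independent_orthogonal A B g : measurable A -> measurable B ->
  (exists f g : T -> R, [/\ cond_prob_version P G A f, cond_prob_version P G B g
     & cond_prob_version P G (A `&` B) (f \* g)]) ->
  bounded_version B g ->
  Ex (fun x => (\1_B x - g x) * \1_A x) = 0.
Proof.
move=> mA mB /(cond_independent_bounded mA mB) [f [g1 [bf bg1 fg1]]] bg.
have [Gf f01 _] := bf.
have [Gg g01 _] := bg.
have [Gg1 g101 _] := bg1.
have mf := measurable_of_preimage Gf.
have mg := measurable_of_preimage Gg.
have mg1 := measurable_of_preimage Gg1.
have intf := integrable_unit mf f01.
have intg := integrable_unit mg g01.
have intA : integ \1_A by exact: integrable_indic.
have intB : integ \1_B by exact: integrable_indic.
have mA1 : measurable_fun setT (\1_A : T -> R) by exact: measurable_indic.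
have mB1 : measurable_fun setT (\1_B : T -> R) by exact: measurable_indic.
have u1 D (x : T) : 0 <= (\1_D x : R) <= 1 by exact: indic_unit.
(* Writing 1_A and 1_B for the indicators, the chain is E[g 1_A] = E[g f] = E[f 1_B] = E[f g1] =
   E[1_A 1_B]. *)
have E1 := bounded_version_orthogonal mA bf intg Gg.
have E2 := bounded_version_orthogonal mB bg intf Gf.
have E3 := bounded_version_orthogonal mB bg1 intf Gf.
have sub (h h1 h2 : T -> R) :
   integ h -> measurable_fun setT h1 -> measurable_fun setT h2 ->
   (forall x, 0 <= h1 x <= 1) -> (forall x, 0 <= h2 x <= 1) ->
   Ex (fun x => h x * (h1 x - h2 x)) =
   Ex (fun x => h x * h1 x) - Ex (fun x => h x * h2 x).
  move=> ? ? ? ? ?; rewrite -RintegralB //; try exact: integrable_mul_unit.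
  by congr Rintegral; apply/funext => x; ring.
rewrite (_ : (fun x => _) = (fun x => \1_A x * (\1_B x - g x))); last first.
  by apply/funext => x; rewrite mulrC.
move: E1 E2 E3; rewrite !sub // ?fg1.
rewrite (_ : (fun x => g x * \1_A x) = (fun x => \1_A x * g x)); last first.
  by apply/funext => x; rewrite mulrC.
rewrite (_ : (fun x => g x * f x) = (fun x => f x * g x)); last first.
  by apply/funext => x; rewrite mulrC.
lra.
Qed.

End ConditionalProbability.

(** * Gaussian vectors *)

Section GaussianVector.
Context d (T : measurableType d) (R : realType) (P : probability T R).
Variables (V : finType) (X : V -> {RV P >-> R}) (mu : V -> R) (S : V -> V -> R).
Hypothesis posS : positive_definite S.
Hypothesis gaussX : gaussian_vector X mu S.
Local Open Scope classical_set_scope.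
Implicit Types (u v w : V) (s t y : V -> R) (A B : set R).

Notation integ f := (P.-integrable setT (EFin \o f)).
Notation Ex f := (Rintegral P setT f).
Notation nontrivial t := (exists v, t v != 0).

Definition linform t : T -> R := fun x => \sum_v t v * (X v x - mu v).

Lemma linform_linear r s t x :
  linform (fun v => s v + r * t v) x = linform s x + r * linform t x.
Proof.
by rewrite /linform mulr_sumr -big_split /=; apply: eq_bigr => v _; ring.
Qed.

Lemma linform_basis u x : linform (basis u) x = X u x - mu u.
Proof. exact: (@sum_basis R V u (fun v => X v x - mu v)). Qed.

Lemma linform0 t : ~ nontrivial t -> linform t = cst 0.
Proof.
move=> t0; apply/funext => x; rewrite /linform big1 // => v _.
have [->|tv] := eqVneq (t v) 0; first by rewrite mul0r.
by exfalso; apply: t0; exists v.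
Qed.

Lemma measurable_linform t : measurable_fun setT (linform t).
Proof.
apply: measurable_sum => v; apply: measurable_funM => //.
exact: measurable_funB.
Qed.

Lemma measurable_linform_preimage t B : measurable B -> measurable (linform t @^-1` B).
Proof. by move=> mB; rewrite -[X in measurable X]setTI; exact: measurable_linform. Qed.

Lemma linform_law t A : nontrivial t -> measurable A ->
  P (linform t @^-1` A) = normal_prob 0 (Num.sqrt (cov S t t)) A.
Proof.
move=> t0 mA; pose m := \sum_v t v * mu v.
pose B := (fun x => x + (- m)) @^-1` A.
have mB : measurable B.
  by rewrite -[X in measurable X]setTI; exact: measurable_addr.
have -> : linform t @^-1` A = (fun x => \sum_v t v * X v x) @^-1` B.
  apply/funext => x; rewrite /preimage /B /=; congr A.
  rewrite /linform /m -sumrN -big_split /=; apply: eq_bigr => v _; ring.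
rewrite (gaussX t0 mB) normal_prob_center //; last first.
  by rewrite gt_eqF // sqrtr_gt0; exact: cov_gt0.
by congr (normal_prob _ _ _); apply/funext => x; rewrite /B /preimage /= addrK.
Qed.

Lemma linform_set1 t k : nontrivial t -> P (linform t @^-1` [set k]) = 0%E.
Proof. by move=> t0; rewrite linform_law //; exact: normal_prob_set1. Qed.

(* The copy of [R] with the Borel sigma-algebra on which [normal_prob] is
   defined. *)
Definition linform_borel t : T -> measurableTypeR R := linform t.

Lemma measurable_linform_borel t : measurable_fun setT (linform_borel t).
Proof. exact: measurable_linform. Qed.

HB.instance Definition _ t :=
  isMeasurableFun.Build _ _ _ _ (linform_borel t) (measurable_linform_borel t).

Lemma integrable_linform t : integ (linform t).
Proof.
have [t0|/linform0 ->] := pselect (nontrivial t); last exact: integrable0.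
have mt := measurable_linform t.
apply/integrableP; split; first exact/measurable_EFinP.
rewrite (_ : (\int[P]_x _)%E =
  (\int[pushforward P (linform_borel t)]_(x in setT) `|x|%:E)%E); last first.
  rewrite ge0_integral_pushforward //.
  by apply/measurable_EFinP; exact: normr_measurable.
rewrite (@eq_measure_integral _ _ _ _ (normal_prob 0 (Num.sqrt (cov S t t)))).
  by apply: integral_normr_normal_prob; rewrite sqrtr_gt0; exact: cov_gt0.
by move=> A mA _; exact: linform_law.
Qed.

Lemma same_law_expectation s t (H : R -> R) : nontrivial s -> nontrivial t ->
    cov S s s = cov S t t -> measurable_fun setT H ->
    integ (H \o linform s) -> integ (H \o linform t) ->
  Ex (H \o linform s) = Ex (H \o linform t).
Proof.
move=> s0 t0 st mH ints intt; rewrite /Rintegral; congr fine.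
have E r : integ (H \o linform r) ->
    (\int[P]_x ((H \o linform r) x)%:E =
     \int[pushforward P (linform_borel r)]_x (H x)%:E)%E.
  move=> intr; rewrite integral_pushforward //; exact/measurable_EFinP.
rewrite !E //; apply: eq_measure_integral => A mA _.
by rewrite [LHS](linform_law s0 mA) [RHS](linform_law t0 mA) st.
Qed.

Lemma expectation_linform t : Ex (linform t) = 0.
Proof.
have [t0|/linform0 ->] := pselect (nontrivial t); last first.
  by rewrite Rintegral_cst // mul0r.
(* The opposite form, shaped for [linform_linear]; it has the same variance, hence the same law. *)
pose t' v := 0 * t v + (-1) * t v.
have t'E x : linform t' x = - linform t x.
  rewrite (linform_linear (-1) (fun v => 0 * t v)) /linform.
  by rewrite big1 ?add0r ?mulN1r // => v _; rewrite !mul0r.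
have t'0 : nontrivial t'.
  by have [v tv] := t0; exists v; rewrite /t' mul0r add0r mulN1r oppr_eq0.
have : Ex (idfun \o linform t) = Ex (idfun \o linform t').
  apply: same_law_expectation => //; [|exact: measurable_id|exact: integrable_linform..].
  rewrite /cov; apply: eq_bigr => u _; apply: eq_bigr => v _; rewrite /t'; ring.
have -> : idfun \o linform t' = (fun x => -1 * linform t x).
  by apply/funext => x; rewrite /= t'E mulN1r.
rewrite RintegralZl //; last exact: integrable_linform.
rewrite (_ : idfun \o linform t = linform t) //; lra.
Qed.

(** The perturbed form has the same covariance with [s] as [s] itself, which is positive. *)
Lemma cov_eq0_nontrivial y s r : cov S y s = 0 -> nontrivial s ->
  nontrivial (fun v => s v + r * y v).
Proof.
move=> ys s0; apply: contrapT => t0.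
have : 0 < cov S s s by exact: cov_gt0.
have <- : cov S (fun v => s v + r * y v) s = cov S s s.
  by rewrite cov_linear ys mulr0 addr0.
rewrite /cov big1 ?ltxx // => u _; apply: big1 => v _.
have [->|tu] := eqVneq (s u + r * y u) 0; first by rewrite !mul0r.
by exfalso; apply: t0; exists u.
Qed.

Lemma cov_perturb y s r : cov S y s = 0 ->
  cov S (fun v => s v + r * y v) (fun v => s v + r * y v) =
  cov S s s + r ^+ 2 * cov S y y.
Proof.
move=> ys; rewrite cov_linear (covC posS s) (covC posS y) !cov_linear.
by rewrite (covC posS s y) ys; ring.
Qed.

(* [s + e y] and [s - e y] have the same law, so the integral of the symmetric
   difference quotient of the positive part at [s - k] vanishes. *)
Lemma expectation_difference_quotient y s k n :
  cov S y s = 0 -> nontrivial s ->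
  Ex (fun x => n.+1%:R / 2 *
    (Num.max (linform s x - k + n.+1%:R^-1 * linform y x) 0 -
     Num.max (linform s x - k - n.+1%:R^-1 * linform y x) 0)) = 0.
Proof.
move=> ys s0; set e : R := n.+1%:R^-1.
pose H (x : R) := Num.max (x - k) 0.
have mH : measurable_fun setT H.
  apply: (measurable_maxr _ (@measurable_cst _ _ _ _ setT (0 : R))).
  exact: (measurable_funB (@measurable_id _ _ setT) (@measurable_cst _ _ _ _ setT k)).
have intH t : integ (H \o linform t).
  apply: (@integrable_le _ _ _ _ _ (fun x => `|linform t x| + `|k| * cst 1 x)).
  - exact: measurableT_comp mH (measurable_linform t).
  - move=> x; rewrite /H /= mulr1 [leRHS]ger0_norm ?addr_ge0 //.
    rewrite ger0_norm ?le_max ?lexx ?orbT // ge_max addr_ge0 // andbT.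
    by rewrite lerD ?ler_norm // -normrN ler_norm.
  - apply: integrable_lin; first exact: (integrable_norm (integrable_linform t)).
    exact: finite_measure_integrable_cst.
have HE r : H \o linform (fun v => s v + r * y v) =
    (fun x => Num.max (linform s x - k + r * linform y x) 0).
  by apply/funext => x; rewrite /H /= linform_linear; congr Num.max; ring.
have : Ex (H \o linform (fun v => s v + e * y v)) =
       Ex (H \o linform (fun v => s v + (- e) * y v)).
  apply: same_law_expectation => //; try exact: cov_eq0_nontrivial.
  by rewrite !cov_perturb // sqrrN.
have := intH (fun v => s v + e * y v); have := intH (fun v => s v + (- e) * y v).
rewrite !HE => int1 int2 E12.
rewrite (_ : (fun x => _) = (fun x => (n.+1%:R / 2 *
    Num.max (linform s x - k + e * linform y x) 0) + (- (n.+1%:R / 2)) *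
     Num.max (linform s x - k + - e * linform y x) 0)); last first.
  by apply/funext => x; rewrite mulNr -mulrBr mulNr.
rewrite expectation_lin //; last exact: (integrableZl _ _ int2).
by rewrite RintegralZl // E12 mulNr subrr.
Qed.

(** For nonzero [a] the quotient is constant once the step is smaller than the absolute value of
    [a]; for [a = 0] it always equals [b / 2], hence the weight one half. *)
Lemma cvg_difference_quotient (a b : R) :
  (fun n => n.+1%:R / 2 * (Num.max (a + n.+1%:R^-1 * b) 0 -
     Num.max (a - n.+1%:R^-1 * b) 0)) @ \oo -->
  b * (\1_`]0, +oo[ a + 2^-1 * \1_[set 0] a).
Proof.
apply: cvg_near_cst.
have n0 n : n.+1%:R != 0 :> R by rewrite pnatr_eq0.
have small n (c : R) : 0 < c -> (Num.truncn (`|b| / c) <= n)%N ->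
    `|n.+1%:R^-1 * b| < c.
  move=> c0 nc; rewrite normrM ger0_norm ?invr_ge0 // mulrC ltr_pdivrMr //.
  rewrite mulrC -ltr_pdivrMr //.
  by rewrite (lt_le_trans (truncnS_gt _)) // ler_nat ltnS.
have [a0|a0|->] := ltgtP a 0.
- exists (Num.truncn (`|b| / - a)) => // n /= na.
  have := small n _ _ na; rewrite oppr_gt0 => /(_ a0) /ltr_normlP[h1 h2].
  move: (n.+1%:R^-1 * b) h1 h2 => x h1 h2.
  rewrite !max_r; [|lra|lra].
  rewrite subrr mulr0 !indicE memNset; last by rewrite /= in_itv /= andbT; lra.
  rewrite memNset ?mulr0 ?addr0 ?mulr0 //; move=> /=; lra.
- exists (Num.truncn (`|b| / a)) => // n /= na.
  have := small n _ a0 na => /ltr_normlP[h1 h2].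
  have [h3 h4] : 0 <= a + n.+1%:R^-1 * b /\ 0 <= a - n.+1%:R^-1 * b.
    by move: (n.+1%:R^-1 * b) h1 h2 => x *; split; lra.
  rewrite !max_l //.
  rewrite !indicE mem_set; last by rewrite /= in_itv /= andbT.
  rewrite memNset; last by move=> /=; lra.
  by rewrite /=; field.
- exists 0%N => // n _.
  rewrite !indicE memNset; last by rewrite /= in_itv /= ltxx.
  rewrite mem_set //= add0r sub0r !add0r.
  have [b0|b0] := leP 0 (n.+1%:R^-1 * b).
    by rewrite max_r ?oppr_le0 //; field.
  by rewrite max_l ?oppr_ge0 ?(ltW b0) //; field.
Qed.

(** The positive part is 1-Lipschitz. *)
Lemma difference_quotient_le (a x n : R) : 0 < n ->
  `|n / 2 * (Num.max (a + n^-1 * x) 0 - Num.max (a - n^-1 * x) 0)| <= `|x|.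
Proof.
move=> n0; rewrite normrM ger0_norm ?divr_ge0 ?(ltW n0) //.
have -> : `|x| = n / 2 * (2 * `|n^-1 * x|).
  by rewrite normrM ger0_norm ?invr_ge0 ?(ltW n0) //; field; rewrite gt_eqF.
rewrite ler_wpM2l ?divr_ge0 ?(ltW n0) //.
move: (n^-1 * x) => {}x.
rewrite ler_norml; have := ler_norm x; have := ler_norm (- x); rewrite normrN.
by case: (leP (a + x) 0) => ?; case: (leP (a - x) 0) => ? ? ?; apply/andP; split; lra.
Qed.

(** The limit of the difference quotients is the wanted integrand plus half of [linform y] on the
    event [N], which is null because normal laws have no atoms. *)
Lemma expectation_uncorrelated_ray y s k : cov S y s = 0 -> nontrivial s ->
  Ex (fun x => linform y x * \1_(linform s @^-1` `]k, +oo[) x) = 0.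
Proof.
move=> ys s0.
pose f x := linform y x *
  (\1_`]0, +oo[ (linform s x - k) + 2^-1 * \1_[set 0] (linform s x - k)).
pose A := linform s @^-1` `]k, +oo[; pose N := linform s @^-1` [set k].
have mA : measurable A by exact: measurable_linform_preimage.
have mN : measurable N by exact: measurable_linform_preimage.
have inty := integrable_linform y.
have fE : f = (fun x => linform y x * \1_A x + 2^-1 * (linform y x * \1_N x)).
  apply/funext => x; rewrite /f mulrDr mulrCA; congr (_ * _ + _ * (_ * _)).
    rewrite !indicE; congr (nat_of_bool _)%:R.
    by apply/idP/idP => /set_mem h; apply: mem_set; move: h;
      rewrite /A /= !in_itv /= !andbT => h; lra.
  rewrite !indicE; congr (nat_of_bool _)%:R.
  by apply/idP/idP => /set_mem h; apply: mem_set; move: h; rewrite /N /= => h; lra.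
have ms := measurable_linform s.
have mpert r :
    measurable_fun setT (fun x => Num.max (linform s x - k + r * linform y x) 0).
  apply: (measurable_maxr _ (@measurable_cst _ _ _ _ setT (0 : R))).
  apply: measurable_funD; first exact: measurable_funB.
  apply: measurable_funM => //; exact: measurable_linform.
have [||||||intf f0] := @expectation_limit0 _ _ _ P
   (fun n x => n.+1%:R / 2 *
    (Num.max (linform s x - k + n.+1%:R^-1 * linform y x) 0 -
     Num.max (linform s x - k - n.+1%:R^-1 * linform y x) 0)) f
   (fun x => `|linform y x|).
- move=> n; apply: measurable_funM => //; apply: measurable_funB; first exact: mpert.
  by have := mpert (- n.+1%:R^-1); under eq_fun do rewrite mulNr.
- rewrite fE; apply: (@integrable_measurable _ _ _ P).
  by apply: integrable_lin; apply: integrable_mul_indic.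
- by move=> x; exact: cvg_difference_quotient.
- exact: (integrable_norm inty).
- by move=> n x; exact: difference_quotient_le.
- by move=> n; exact: expectation_difference_quotient.
move: f0; rewrite fE expectation_lin; [|exact: integrable_mul_indic..].
by rewrite (expectation_mul_indic_null inty mN) ?mulr0 ?addr0 //; exact: linform_set1.
Qed.

Lemma sum_indic_trivIset (F : nat -> set R) n z : trivIset setT F ->
  \sum_(i < n) \1_(F i) z = [exists i : 'I_n, z \in F i]%:R :> R.
Proof.
move=> tF; case: (boolP [exists _, _]) => [/existsP[i zi]|nz] /=.
  rewrite (bigD1 i) //= indicE zi big1 ?addr0 // => j ji; rewrite indicE.
  case: (boolP (z \in F j)) => // zj; case/eqP: ji; apply: val_inj.
  by apply: tF => //; exists z; split; exact: set_mem.
apply: big1 => i _; rewrite indicE; case: (boolP (z \in F i)) => // zi.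
by case/existsP: nz; exists i.
Qed.

(** Open rays form a pi-system generating the Borel sets. The good sets are stable under complement
    because [linform y] has mean 0, and under disjoint unions by dominated convergence. *)
Lemma expectation_uncorrelated y s B : cov S y s = 0 -> nontrivial s ->
  measurable B -> Ex (fun x => linform y x * \1_(linform s @^-1` B) x) = 0.
Proof.
move=> ys s0 mB; have inty := integrable_linform y.
pose Q : set_system (measurableTypeR R) :=
  [set C | Ex (fun x => linform y x * \1_(linform s @^-1` C) x) = 0].
suff : Q B by [].
apply: (@dynkin_induction _ (measurableTypeR R) (@RGenOInfty.G R) Q) => //.
- exact: RGenOInfty.measurableE.
- move=> _ _ [a ->] [b ->]; exists (Num.max a b); apply/seteqP.
  by split=> x /=; rewrite !in_itv /= !andbT gt_max => /andP.
- rewrite /Q /= preimage_setT.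
  rewrite -[RHS](expectation_linform y); congr Rintegral.
  by apply/funext => x; rewrite indicT mulr1.
- by move=> _ [k ->]; exact: expectation_uncorrelated_ray.
- move=> C mC QC; rewrite /Q /=.
  have -> : (fun x => linform y x * \1_(linform s @^-1` (~` C)) x) =
     (fun x => linform y x + (-1) * (linform y x * \1_(linform s @^-1` C) x)).
    apply/funext => x; rewrite !indicE preimage_setC in_setC.
    by case: (_ \in _) => /=; lra.
  have mpC : measurable (linform s @^-1` C) by exact: measurable_linform_preimage.
  rewrite expectation_lin //; last exact: integrable_mul_indic.
  by rewrite expectation_linform QC mulr0 addr0.
- move=> F mF tF QF; rewrite /Q /=.
  have mpF n : measurable (linform s @^-1` (F n)).
    by apply: measurable_linform_preimage; exact: mF.
  pose g n x := \sum_(i < n) linform y x * \1_(linform s @^-1` F i) x.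
  have intg n : integ (g n) /\ Ex (g n) = 0.
    by apply: expectation_sum0 => i; [exact: integrable_mul_indic|exact: QF].
  have gE n x : g n x = linform y x * [exists i : 'I_n, linform s x \in F i]%:R.
    by rewrite /g -mulr_sumr -(sum_indic_trivIset _ _ tF).
  have [||||||//] := @expectation_limit0 _ _ _ P g
     (fun x => linform y x * \1_(linform s @^-1` (\bigcup_k F k)) x)
     (fun x => `|linform y x|).
  + by move=> n; exact: (integrable_measurable (intg n).1).
  + apply: (@integrable_measurable _ _ _ P); apply: integrable_mul_indic => //.
    by apply: measurable_linform_preimage; exact: bigcupT_measurable.
  + move=> x; apply: cvg_near_cst.
    have [[k _ Fk]|nF] := pselect ((\bigcup_k F k) (linform s x)).
      exists k.+1 => // n /= kn; rewrite gE indicE mem_set; last by exists k.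
      congr (_ * (nat_of_bool _)%:R).
      by apply/existsP; exists (Ordinal kn); exact: mem_set.
    exists 0%N => // n _; rewrite gE indicE memNset //.
    congr (_ * (nat_of_bool _)%:R); apply/negbTE/existsPn => i.
    by apply/negP => /set_mem Fi; apply: nF; exists i.
  + exact: (integrable_norm inty).
  + move=> n x; rewrite gE normrM ler_piMr //.
    by rewrite ger0_norm //; case: [exists _, _].
  + by move=> n; exact: (intg n).2.
- by rewrite -[X in X B]RGenOInfty.measurableE.
Qed.

(** The residual of [y] after regression on [s] integrates to 0 over the half-space, hence so does
    [k] times [linform s]. If [k] were nonzero, the positive part of [linform s] would vanish almost
    surely, then, the mean being 0, all of it, although its law has no atoms. *)
Lemma cov_eq0_of_halfline y s : nontrivial s ->
  Ex (fun x => linform y x * \1_(linform s @^-1` `]0, +oo[) x) = 0 ->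
  cov S y s = 0.
Proof.
move=> s0 ys; have ss0 : 0 < cov S s s by exact: cov_gt0.
pose k := cov S y s / cov S s s.
pose A := linform s @^-1` `]0, +oo[.
have mA : measurable A by exact: measurable_linform_preimage.
have : Ex (fun x => linform (fun v => y v + (- k) * s v) x * \1_A x) = 0.
  apply: expectation_uncorrelated => //.
  by rewrite cov_linear /k mulNr divfK ?subrr // gt_eqF.
rewrite (_ : (fun x => _) = (fun x => linform y x * \1_A x +
  (- k) * (linform s x * \1_A x))); last first.
  by apply/funext => x; rewrite linform_linear; ring.
have intA t : integ (fun x => linform t x * \1_A x).
  by apply: integrable_mul_indic => //; exact: integrable_linform.
rewrite expectation_lin // ys add0r => /eqP; rewrite mulf_eq0 oppr_eq0.
case/orP => [/eqP k0|/eqP sA0].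
  by rewrite -[LHS](@divfK _ (cov S s s)) ?gt_eqF // -/k k0 mul0r.
exfalso.
have ints := integrable_linform s.
have ae1 : {ae P, forall x, linform s x * \1_A x = 0}.
  apply: expectation_ge0_eq0 => // x; rewrite indicE.
  case: (boolP (x \in A)) => [/set_mem|_]; last by rewrite mulr0.
  by rewrite /A /= in_itv /= andbT mulr1 => /ltW.
have ae2 : {ae P, forall x, linform s x * \1_A x + (-1) * linform s x = 0}.
  apply: expectation_ge0_eq0; first exact: integrable_lin.
    move=> x; rewrite indicE; case: (boolP (x \in A)) => [_|/negP xA].
      by rewrite mulr1 mulN1r subrr.
    rewrite mulr0 add0r mulN1r oppr_ge0 leNgt; apply/negP => s_gt0; apply: xA.
    by apply: mem_set; rewrite /A /= in_itv /= andbT.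
  by rewrite expectation_lin // sA0 expectation_linform mulr0 addr0.
have mN : measurable (linform s @^-1` [set 0]) by exact: measurable_linform_preimage.
have N0 : P (~` (linform s @^-1` [set 0])) = 0%E.
  apply/negligibleP; first exact: measurableC.
  have : {ae P, forall x, linform s x = 0}.
    by apply: filterS2 ae1 ae2 => x e1; rewrite e1; lra.
  by [].
have := probability_setT P; rewrite -(setvU (linform s @^-1` [set 0])).
rewrite measureU //; [|exact: measurableC|exact: setICl].
rewrite [X in (X + _)%E]N0 [X in (_ + X)%E]linform_set1 // adde0.
by move=> /eqP; rewrite eqe eq_sym oner_eq0.
Qed.

End GaussianVector.

(** * Consequences of the Markov property *)

Section SigmaOf.
Context d (T : measurableType d) (R : realType) (P : probability T R).
Variables (V : finType) (X : V -> {RV P >-> R}).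
Local Open Scope classical_set_scope.
Implicit Types (u v w : V) (S : {set V}).

Lemma sigma_of_preimage v S (B : set R) : v \in S -> measurable B ->
  sigma_of X S (X v @^-1` B).
Proof. by move=> vS mB; apply: sub_sigma_algebra; exists v, B. Qed.

Lemma sigma_of_measurable S : sigma_of X S `<=` measurable.
Proof.
apply: smallest_sub; first exact: sigma_algebra_measurable.
move=> _ [v [B [_ mB ->]]]; rewrite -[X in measurable X]setTI.
exact: (measurable_funPT (X v)).
Qed.

Lemma sigma_of_set1 w (C : set T) : sigma_of X [set w]%SET C ->
  exists2 B : set R, measurable B & C = X w @^-1` B.
Proof.
pose Q := [set C : set T | exists2 B : set R, measurable B & C = X w @^-1` B].
suff : sigma_of X [set w]%SET `<=` Q by apply.
apply: smallest_sub; last first.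
  by move=> _ [v [B [/set1P -> mB ->]]]; exists B.
split=> [|_ [B mB ->]|F QF].
- by exists set0 => //; rewrite preimage_set0.
- by exists (~` B); [exact: measurableC|rewrite setTD preimage_setC].
- have /choice[B BE] : forall n, exists B : set R, measurable B /\ F n = X w @^-1` B.
    by move=> n; have [B] := QF n; exists B.
  exists (\bigcup_n B n); first by apply: bigcupT_measurable => n; exact: (BE n).1.
  by rewrite preimage_bigcup; apply: eq_bigcupr => n _; exact: (BE n).2.
Qed.

Lemma sigma_of_set0 (C : set T) : sigma_of X finset.set0 C -> C = set0 \/ C = setT.
Proof.
pose Q := [set C : set T | C = set0 \/ C = setT].
suff : sigma_of X finset.set0 `<=` Q by apply.
apply: smallest_sub; last by move=> A [v [B []]]; rewrite finset.in_set0.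
split=> [|_ [] ->|F QF].
- by left.
- by right; rewrite setD0.
- by left; rewrite setDv.
- have [[n Fn]|nF] := pselect (exists n, F n = setT).
    by right; apply/seteqP; split=> // x _; exists n => //; rewrite Fn.
  left; apply/seteqP; split=> // x [n _].
  by case: (QF n) => Fn; [rewrite Fn|case: nF; exists n].
Qed.

(** A version measurable for the trivial sigma-algebra is constant, equal to the probability of its
    event. *)
Lemma cond_independent_set0 u v :
  cond_independent X [set u]%SET [set v]%SET finset.set0 -> independent (X u) (X v).
Proof.
move=> ci A0 B0 mA0 mB0; set A := X u @^-1` A0; set B := X v @^-1` B0.
have sA : sigma_of X [set u]%SET A by apply: sigma_of_preimage => //; exact/set1P.
have sB : sigma_of X [set v]%SET B by apply: sigma_of_preimage => //; exact/set1P.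
have mA := sigma_of_measurable sA.
have mB := sigma_of_measurable sB.
have [f [g [bf bg fg]]] :=
  cond_independent_bounded (@sigma_of_measurable finset.set0) mA mB (ci _ _ sA sB).
have cstE C h : measurable C -> bounded_version P (sigma_of X finset.set0) C h ->
    h = cst (fine (P C)).
  move=> mC [Gh _ hC]; apply/funext => x.
  have hx : h = cst (h x).
    have := sigma_of_set0 (Gh [set h x] (measurable_set1 _)).
    case=> /seteqP[s1 s2]; first by have := s1 x erefl.
    by apply/funext => y; exact: (s2 y I).
  have GT : sigma_of X finset.set0 setT.
    by rewrite -(preimage_setT h); apply: Gh; exact: measurableT.
  have := hC _ GT; rewrite expectation_indicI // setIT => <-.
  rewrite (_ : (fun y => _) = cst (h x)).
    by rewrite Rintegral_probability_cst.
  by rewrite hx; apply/funext => y; rewrite /= indicT mulr1.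
move: fg; rewrite (cstE _ _ mA bf) (cstE _ _ mB bg) /=.
rewrite expectation_indicI // Rintegral_probability_cst => e.
rewrite -[LHS]fineK ?fin_num_measure -?e ?EFinM ?fineK ?fin_num_measure //.
exact: measurableI.
Qed.

End SigmaOf.

(** * From independence to covariance identities *)

Section GaussianMarkov.
Context d (T : measurableType d) (R : realType) (P : probability T R).
Variables (V : finType) (X : V -> {RV P >-> R}) (mu : V -> R) (S : V -> V -> R).
Hypothesis posS : positive_definite S.
Hypothesis gaussX : gaussian_vector X mu S.
Local Open Scope classical_set_scope.
Implicit Types (u v w : V).

Notation integ f := (P.-integrable setT (EFin \o f)).
Notation Ex f := (Rintegral P setT f).
Notation L := (linform X mu).

Lemma linform_basis_preimage u (B : set R) :
  L (basis u) @^-1` B = X u @^-1` ((fun x => x - mu u) @^-1` B).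
Proof. by apply/funext => x; rewrite /preimage /= linform_basis. Qed.

Lemma preimage_linform_basis u (B : set R) :
  X u @^-1` B = L (basis u) @^-1` ((fun x => x + mu u) @^-1` B).
Proof. by apply/funext => x; rewrite /preimage /= linform_basis subrK. Qed.

Lemma measurable_shift (c : R) (B : set R) : measurable B ->
  measurable ((fun x => x + c) @^-1` B).
Proof. by move=> mB; rewrite -[X in measurable X]setTI; exact: measurable_addr. Qed.

Lemma sigma_of_linform v (Z : {set V}) (B : set R) : v \in Z -> measurable B ->
  sigma_of X Z (L (basis v) @^-1` B).
Proof.
move=> vZ mB; rewrite linform_basis_preimage; apply: sigma_of_preimage => //.
exact: measurable_shift.
Qed.

(** The centred indicator of the half-space of [v] is orthogonal to all events of [u], hence to the
    linear form of [u]; the half-space criterion concludes. *)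
Lemma independent_cov_eq0 u v : independent (X u) (X v) -> S u v = 0.
Proof.
move=> ind; rewrite -(cov_basis S u v).
apply: (cov_eq0_of_halfline posS gaussX (basis_neq0 R v)).
set A := L (basis v) @^-1` _.
have mA : measurable A by exact: measurable_linform_preimage.
have intu := integrable_linform posS gaussX (basis u).
pose p := fine (P A).
have intA : integ \1_A by exact: integrable_indic.
have intc : integ (cst 1) by exact: finite_measure_integrable_cst.
have orth : Ex (fun x => L (basis u) x * (\1_A x + (- p) * cst 1 x)) = 0.
  apply: expectation_mul_eq0.
  - exact: measurable_linform.
  - exact: integrable_lin.
  - rewrite (_ : (fun x => _) =
        (fun x => L (basis u) x * \1_A x + (- p) * L (basis u) x)).
      by apply: integrable_lin => //; exact: integrable_mul_indic.
    by apply/funext => x /=; ring.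
  move=> B mB; set C := L (basis u) @^-1` B.
  have mC : measurable C by exact: measurable_linform_preimage.
  have intC : integ \1_C by exact: integrable_indic.
  rewrite (_ : (fun x => _) = (fun x => \1_A x * \1_C x + (- p) * \1_C x)); last first.
    by apply/funext => x /=; ring.
  rewrite expectation_lin //; last exact: integrable_mul_indic.
  rewrite expectation_indicI // setIC.
  rewrite [X in _ * X](_ : _ = fine (P C)); last first.
    by rewrite /Rintegral integral_indic // setIT.
  rewrite /A /C !linform_basis_preimage ind; try exact: measurable_shift.
  by rewrite fineM ?fin_num_measure -?linform_basis_preimage // /p mulNr mulrC subrr.
move: orth; rewrite (_ : (fun x => _) =
  (fun x => L (basis u) x * \1_A x + (- p) * L (basis u) x)); last first.
  by apply/funext => x /=; ring.
rewrite expectation_lin //; last exact: integrable_mul_indic.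
by rewrite (expectation_linform posS gaussX) mulr0 addr0.
Qed.

(** The identity says that [y], the residual of [u] after regression on [w], is uncorrelated with
    [v]. The half-space criterion is checked by splitting the indicator of [B] into a version [g] of
    its conditional probability and the remainder. *)
Lemma cond_independent_cov u v w :
  cond_independent X [set u]%SET [set v]%SET [set w]%SET ->
  S u v * S w w = S u w * S w v.
Proof.
move=> ci; pose k := S u w / S w w; pose y t := basis u t + (- k) * basis w t.
have ww0 := variance_gt0 posS w.
suff : cov S y (basis v) = 0.
  rewrite cov_linear !cov_basis /k => e.
  have -> : S u v = S u w / S w w * S w v by lra.
  by field; rewrite gt_eqF.
apply: (cov_eq0_of_halfline posS gaussX (basis_neq0 R v)).
set B := L (basis v) @^-1` _.
have uu : u \in [set u]%SET by exact/set1P.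
have vv : v \in [set v]%SET by exact/set1P.
have ww : w \in [set w]%SET by exact/set1P.
have sB : sigma_of X [set v]%SET B by exact: sigma_of_linform.
have sT : sigma_of X [set u]%SET setT.
  by rewrite -(preimage_setT (X u)); exact: sigma_of_preimage.
have mB := sigma_of_measurable sB.
have Gm := @sigma_of_measurable _ _ _ _ _ X [set w]%SET.
have [_ [g [_ bg _]]] := cond_independent_bounded Gm measurableT mB (ci _ _ sT sB).
have [Gg g01 _] := bg; have mg := measurable_of_preimage Gm Gg.
have intg := integrable_unit P mg g01.
have intB : integ \1_B by exact: integrable_indic.
have intL t := integrable_linform posS gaussX t.
have intLg t : integ (fun x => L t x * g x) by exact: integrable_mul_unit.
have intLB t : integ (fun x => L t x * \1_B x) by exact: integrable_mul_indic.
have diffE t : (fun x => L t x * (\1_B x - g x)) =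
    (fun x => L t x * \1_B x + (-1) * (L t x * g x)).
  by apply/funext => x; ring.
(* Conditional independence makes the remainder orthogonal to the events of [u]. *)
have Eu : Ex (fun x => L (basis u) x * (\1_B x - g x)) = 0.
  apply: expectation_mul_eq0.
  - exact: measurable_linform.
  - exact: (integrableB measurableT intB intg).
  - by rewrite diffE; exact: integrable_lin.
  move=> D mD; have sA := sigma_of_linform uu mD.
  exact: (cond_independent_orthogonal Gm (sigma_of_measurable sA) mB (ci _ _ sA sB) bg).
have Ew : Ex (fun x => L (basis w) x * (\1_B x - g x)) = 0.
  by apply: (bounded_version_orthogonal Gm mB bg) => // D mD; exact: sigma_of_linform.
(* The events of [g] are events of [X w], and [y] is uncorrelated with [w]. *)
have Ey : Ex (fun x => L y x * g x) = 0.
  rewrite (_ : (fun x => _) = (fun x => g x * L y x)); last first.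
    by apply/funext => x; rewrite mulrC.
  apply: expectation_mul_eq0 => //.
    rewrite (_ : (fun x => _) = (fun x => L y x * g x)) //.
    by apply/funext => x; rewrite mulrC.
  move=> D mD; have [D' mD' ->] := sigma_of_set1 (Gg _ mD).
  rewrite preimage_linform_basis; apply: (expectation_uncorrelated posS gaussX).
  - by rewrite cov_linear !cov_basis /k mulNr divfK ?subrr // gt_eqF.
  - exact: basis_neq0.
  - exact: measurable_shift.
have : Ex (fun x => L y x * (\1_B x - g x)) = 0.
  rewrite (_ : (fun x => _) = (fun x => L (basis u) x * (\1_B x - g x) +
      (- k) * (L (basis w) x * (\1_B x - g x)))); last first.
    by apply/funext => x; rewrite linform_linear; ring.
  rewrite expectation_lin ?Eu ?Ew ?mulr0 ?addr0 //.
    by rewrite diffE; exact: integrable_lin.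
  by rewrite diffE; exact: integrable_lin.
by rewrite diffE expectation_lin // Ey mulr0 addr0.
Qed.

End GaussianMarkov.

(** * Sign of the difference in a Gaussian polytree *)

Section GaussianPolytree.
Context d (T : measurableType d) (R : realType) (P : probability T R).
Variables (V : finType) (E : rel V).
Variables (X : V -> {RV P >-> R}) (mu : V -> R) (S : V -> V -> R).
Hypothesis GP : gaussian_polytree E X mu S.
Implicit Types (u v w : V).

Let posS : positive_definite S. Proof. by case: GP. Qed.

Lemma independent_sym u v : independent (X u) (X v) -> independent (X v) (X u).
Proof. by move=> uv A B mA mB; rewrite setIC uv // muleC. Qed.

Lemma d_separated_independent u v : u != v ->
  d_separated E u v finset.set0 -> independent (X u) (X v).
Proof.
move=> uv uv0; apply: cond_independent_set0; apply: (gp_markov GP).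
- by rewrite disjoints1 inE.
- by rewrite disjoints1 finset.in_set0.
- by rewrite disjoints1 finset.in_set0.
- by move=> x y /set1P -> /set1P ->.
Qed.

Lemma separates_corr u v w : u != v -> separates E w u v ->
  corr S u v = corr S u w * corr S w v.
Proof.
move=> uv; have [-> _|wu] := eqVneq w u; first by rewrite corrxx // mul1r.
have [-> _|wv] := eqVneq w v; first by rewrite corrxx // mulr1.
case=> [/eqP|/eqP|sep]; [by rewrite (negPf wu)|by rewrite (negPf wv)|].
apply: corr_chain => //; apply: (cond_independent_cov posS (gp_gaussian GP)).
apply: (gp_markov GP).
- by rewrite disjoints1 inE.
- by rewrite disjoints1 inE eq_sym.
- by rewrite disjoints1 inE eq_sym.
- by move=> x y /set1P -> /set1P ->.
Qed.

Lemma independent_corr u v : independent (X u) (X v) -> corr S u v = 0.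
Proof.
move=> ind; apply/eqP; rewrite corr_eq0 //; apply/eqP.
exact: (independent_cov_eq0 posS (gp_gaussian GP)).
Qed.

Lemma sq_partial_corr_cases a b c z : a != c -> c != b -> z != a -> z != b ->
    z != c -> ancestor E a c -> ancestor E c b ->
  sq_partial_corr S a c [set b; z]%SET <> sq_partial_corr S a c [set b]%SET ->
  [/\ independent (X a) (X z), corr S c z != 0
    & sq_partial_corr S a c [set b]%SET < sq_partial_corr S a c [set b; z]%SET] \/
  (corr S a z != 0 \/ independent (X c) (X z)) /\
  sq_partial_corr S a c [set b; z]%SET < sq_partial_corr S a c [set b]%SET.
Proof.
move=> ac cb za zb zc anc_ac anc_cb.
have [tree _ _ _] := GP.
(* Otherwise the directed paths from [a] to [c] and back would repeat a vertex. *)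
have ab : a != b.
  apply/eqP => ab; move: anc_cb; rewrite -ab => /connectP[p cp aE].
  move: anc_ac => /connectP[q aq cE].
  have : path E c (p ++ q) by rewrite cat_path cp -aE aq.
  move/(dag_path_uniq tree); rewrite cons_uniq mem_cat.
  case: q cE aq => [ca|y q cE _]; first by rewrite /= ca eqxx in ac.
  have -> : c \in y :: q by rewrite cE /= mem_last.
  by rewrite orbT.
have az : a != z by rewrite eq_sym.
have bz : b != z by rewrite eq_sym.
have cz : c != z by rewrite eq_sym.
have [sepab cases] := separation_cases tree anc_ac anc_cb ac cb za zb zc.
have abE := separates_corr ab sepab.
rewrite (sq_partial_corr1 posS ab cb abE).
rewrite (sq_partial_corr2 posS bz ab az cb cz abE).
have D0 := corr_lt1 posS bz.
have s1 := corr_lt1 posS cb.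
have r1 := corr_lt1 posS ac.
have al1 := corr_lt1 posS az.
have ga1 := corr_lt1 posS cz.
have rs1 := corr_lt1 posS ab.
have Da := pcov_bz_gt0 posS bz ab az.
have Dc := pcov_bz_gt0 posS bz cb cz.
have zaC := corrC posS z a; have zcC := corrC posS z c.
have zbC := corrC posS z b; have bcC := corrC posS b c.
rewrite abE in rs1 Da.
case: cases => [[sepzb [m [mza mzc mac]]]|[sepzb za0]|[za0 zc0]|[cza [m [mzc mzb mbc]]]].
- have beE := separates_corr zb sepzb.
  have e1 := separates_corr za mza; have e2 := separates_corr zc mzc.
  have e3 := separates_corr ac mac.
  have [p1 q1 t1] := And3 (corr_le1 posS a m) (corr_le1 posS m c) (corr_le1 posS m z).
  have := @pcor_common_cause _ (corr S a m) (corr S m c) (corr S m z) (corr S c b).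
  cbv zeta.
  have -> : corr S m c * corr S m z = corr S c z.
    by rewrite -zcC e2 (corrC posS z m) mulrC.
  have -> : corr S a m * corr S m z = corr S a z.
    by rewrite -zaC e1 (corrC posS z m) (corrC posS m a) mulrC.
  have -> : corr S c b * corr S c z = corr S b z by rewrite -zbC beE zcC mulrC.
  rewrite -e3 => /(_ D0 Da Dc s1 r1 al1 ga1 p1 q1 t1 rs1) H /H [al0 lt].
  by right; split=> //; left.
- have beE : corr S b z = corr S c b * corr S c z.
    by rewrite -zbC (separates_corr zb sepzb) zcC mulrC.
  have ind := independent_sym (d_separated_independent za za0).
  have al0 := independent_corr ind.
  rewrite al0 beE in D0 Da Dc *.
  by move=> /(pcor_collider D0 Da Dc s1 ga1 rs1) [ga0 lt]; left.
- have ind := independent_sym (d_separated_independent zc zc0).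
  have al0 := independent_corr (independent_sym (d_separated_independent za za0)).
  (* Both correlations with [z] vanish, so the chain identity holds trivially. *)
  have alE : corr S a z = corr S a c * corr S c z.
    by rewrite al0 (independent_corr ind) mulr0.
  rewrite alE in Da *.
  move=> /(pcor_chain D0 Da Dc s1 r1 rs1) [_ _ lt].
  by right; split=> //; right.
- have alE : corr S a z = corr S a c * corr S c z.
    by rewrite -zaC (separates_corr za cza) zcC (corrC posS c a) mulrC.
  rewrite alE in Da *.
  move=> /(pcor_chain D0 Da Dc s1 r1 rs1) [r0 g0 lt].
  right; split=> //; left; rewrite mulf_neq0 //.
  (* If [c] and [z] are uncorrelated, then [m] is uncorrelated with one of them. This kills the
     correlation of [b] with that one too, and so the product of the correlations of [cb] and
     [bz]. *)
  apply: contra_neq g0 => ga0; rewrite ga0 sub0r.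
  have e1 := separates_corr zc mzc; have e2 := separates_corr zb mzb.
  have bc : b != c by rewrite eq_sym.
  have e3 := separates_corr bc mbc.
  have : corr S z m * corr S m c == 0 by rewrite -e1 zcC ga0.
  rewrite -bcC e3 -zbC e2 mulf_eq0 => /orP[] /eqP ->.
    by rewrite mul0r mulr0 oppr0.
  by rewrite mulr0 mul0r oppr0.
Qed.

End GaussianPolytree.

Theorem theorem9 (d : measure_display) (T : measurableType d) (R : realType)
    (P : probability T R) (V : finType) (E : rel V)
    (X : V -> {RV P >-> R}) (mu : V -> R) (Sigma : V -> V -> R)
    (hG : gaussian_polytree E X mu Sigma)
    (a b c z : V) (hac : a != c) (hcb : c != b)
    (anc_ac : ancestor E a c)
    (anc_cb : ancestor E c b)
    (hz : z \notin [set a; b; c]%SET)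
    (hneq : sq_partial_corr Sigma a c [set b; z]%SET
              <> sq_partial_corr Sigma a c [set b]%SET) :
  (sq_partial_corr Sigma a c [set b]%SET
     < sq_partial_corr Sigma a c [set b; z]%SET
   <-> independent (X a) (X z) /\ ~ independent (X c) (X z))
  /\
  (sq_partial_corr Sigma a c [set b; z]%SET
     < sq_partial_corr Sigma a c [set b]%SET
   <-> independent (X c) (X z) \/ ~ independent (X a) (X z)).
Proof.
move: hz; rewrite !inE !negb_or => /andP[/andP[za zb] zc].
have indC u : independent (X u) (X z) -> corr Sigma u z = 0.
  by move/(independent_corr hG).
(* Each alternative has a strict inequality, which refutes the opposite one, and decides both
   independence conditions; this gives all four implications. *)
case: (sq_partial_corr_cases hG hac hcb za zb zc anc_ac anc_cb hneq).
- move=> [ia c0 lt]; have nc : ~ independent (X c) (X z).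
    by move/indC => e; rewrite e eqxx in c0.
  split; split=> //; first by rewrite ltNge (ltW lt).
  by case.
- move=> [side lt]; split; split=> //.
  + by rewrite ltNge (ltW lt).
  + case=> ia nc; case: side => // a0.
    by move/indC: ia => e; rewrite e eqxx in a0.
  + move=> _; case: side => [a0|ic]; [right|by left].
    by move/indC => e; rewrite e eqxx in a0.
Qed.
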